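(* Let $(R,\mathfrak m)$ be a Cohen-Macaulay local ring of dimension two with infinite residue field, let $I,J$ be $\mathfrak m$-primary ideals of $R$, and let $(a,b)$ be a Rees-joint reduction of $I$ and $J$. Let $r_0,s_0\ge0$ be fixed integers. Then the following statements are equivalent: (a) $\ell_R([H^2_{(at_1,bt_2)}(\mathcal R')]_{(r_0,s_0)})<\infty$; (b) $e_{(0,1)}=g_1(r_0)+r_0e_{(1,1)}$ and $e_{(1,0)}=h_1(s_0)+s_0e_{(1,1)}$; (c) $M^1_{i,*}=0$ for all $i\ge r_0$ and $M^1_{*,j}=0$ for all $j\ge s_0$. If any of these equivalent conditions holds, then $$\ell_R([H^2_{(at_1,bt_2)}(\mathcal R')]_{(r_0,s_0)})=-e_2(IJ)+g_2(r_0)+h_2(s_0)-\ell(R/I^{r_0}J^{s_0})+r_0s_0e_{(1,1)}+\ell\left(\frac{\widetilde{\mathcal F}_{(a,b)}(I^{r_0},J^{s_0})}{I^{r_0}J^{s_0}}\right).$$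
   Context: $\ell=\ell_R$ denotes length of $R$-modules. $I^n=J^n=R$ for $n\le0$. A pair $(a,b)$ is a joint reduction of $I$ and $J$ if $a\in I$, $b\in J$ and $I^{r+1}J^{s+1}=aI^rJ^{s+1}+bI^{r+1}J^s$ for all large $r,s$. It is a Rees-joint reduction if moreover $(a)\cap I^rJ^s=aI^{r-1}J^s$ for $r\gg0$ and all $s\ge0$, and $(b)\cap I^rJ^s=bI^rJ^{s-1}$ for $s\gg0$ and all $r\ge0$. $\mathcal R'=\bigoplus_{r,s\in\mathbb Z}I^rJ^st_1^rt_2^s\subseteq R[t_1^{\pm1},t_2^{\pm1}]$ is the bigraded extended Rees algebra; $H^2_{(at_1,bt_2)}(\mathcal R')$ is its second local cohomology module with support in the ideal $(at_1,bt_2)$, and $[\,\cdot\,]_{(r,s)}$ is the bigraded component. For $r,s\ge0$: $M^1_{r,s}:=\dfrac{I^{r+1}J^{s+1}}{aI^rJ^{s+1}+bI^{r+1}J^s}$. For fixed $i$, $\ell(M^1_{i,s})$ is independent of $s$ for $s\gg0$; this number is denoted $M^1_{i,*}$. For fixed $j$, $\ell(M^1_{r,j})$ is independent of $r$ for $r\gg0$; this number is denoted $M^1_{*,j}$. $\widetilde{\mathcal F}_{(a,b)}(I^r,J^s):=\bigcup_{k\ge1}\big((I^{r+k}J^s:a^k)\cap(I^rJ^{s+k}:b^k)\big)$. Hilbert coefficients: for an $\mathfrak m$-primary ideal $K$, $\ell(R/K^n)=e_0(K)\binom{n+1}{2}-e_1(K)n+e_2(K)$ for $n\gg0$. Bigraded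 Hilbert coefficients $e_{(i,j)}$ of $\{I^rJ^s\}$: $\ell(R/I^rJ^s)=\sum_{i+j\le 2}(-1)^{i+j}e_{(i,j)}\binom{r+i-1}{i}\binom{s+j-1}{j}$ for all $r,s\gg0$. For each fixed $r\ge0$ there are integers $g_1(r),g_2(r)$ with $\ell(R/I^rJ^s)=e_0(J)\binom{s+1}{2}-g_1(r)s+g_2(r)$ for all $s\gg0$; for each fixed $s\ge0$ there are integers $h_1(s),h_2(s)$ with $\ell(R/I^rJ^s)=e_0(I)\binom{r+1}{2}-h_1(s)r+h_2(s)$ for all $r\gg0$. *)

(* Defs.v *)
From HB Require Import structures.
From mathcomp Require Import all_boot all_order all_algebra finmap ring.
From mathcomp Require Import monalg.
From mathcomp Require Import boolp classical_sets cardinality constructive_ereal.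

Set Implicit Arguments.
Unset Strict Implicit.
Unset Printing Implicit Defensive.

Import Order.TTheory GRing.Theory Num.Theory.

Local Open Scope classical_set_scope.
Local Open Scope ring_scope.
Local Open Scope quotient_scope.

Definition eventually (P : nat -> Prop) : Prop :=
  exists N : nat, forall n : nat, (N <= n)%N -> P n.

Definition is_max_nat (P : set nat) (n : nat) : Prop :=
  P n /\ forall k, P k -> (k <= n)%N.

Section Length.
Variables (R : nzRingType) (V : lmodType R).

Definition is_submodule (N : set V) : Prop :=
  [/\ N 0, forall u v, N u -> N v -> N (u + v)
    & forall (c : R) u, N u -> N (c *: u)].

(* n is the length of a strictly increasing chain of submodules between N and
   M, i.e. of a strictly increasing chain of submodules of M / N. *)
Definition chain_between (N M : set V) (n : nat) : Prop :=
  exists C : nat -> set V,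
    (forall i, (i <= n)%N -> [/\ is_submodule (C i), N `<=` C i & C i `<=` M]) /\
    (forall i, (i < n)%N -> C i `<` C i.+1).

(* The length of the subquotient M / N, for submodules N `<=` M of V. *)
Definition length (N M : set V) : \bar int :=
  match pselect (exists n, is_max_nat (chain_between N M) n) with
  | left h => (projT1 (cid h))%:Z%:E
  | right _ => +oo%E
  end.

End Length.

Identity Coercion fun_of_set : set >-> Funclass.

Record ideal (R : comNzRingType) := Ideal {
  ideal_set :> set R;
  ideal_0 : ideal_set 0;
  ideal_D : forall x y, ideal_set x -> ideal_set y -> ideal_set (x + y);
  ideal_M : forall c x, ideal_set x -> ideal_set (c * x)
}.

Section Ideals.
Variable R : comNzRingType.
Implicit Types (I J K m : ideal R).

Definition ideal_top : ideal R :=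
  @Ideal R setT Logic.I (fun _ _ _ _ => Logic.I) (fun _ _ _ => Logic.I).

Definition ideal_mul_set (I J : set R) : set R :=
  [set x | exists s : seq (R * R),
     (forall p, p \in s -> I p.1 /\ J p.2) /\ x = \sum_(p <- s) p.1 * p.2].

Lemma ideal_mul0 I J : ideal_mul_set I J 0.
Proof. by exists [::]; rewrite big_nil. Qed.

Lemma ideal_mulD I J x y :
  ideal_mul_set I J x -> ideal_mul_set I J y -> ideal_mul_set I J (x + y).
Proof.
move=> [s [sP ->]] [t [tP ->]]; exists (s ++ t); rewrite big_cat; split=> // p.
by rewrite mem_cat => /orP[/sP|/tP].
Qed.

Lemma ideal_mulM I J c x : ideal_mul_set I J x -> ideal_mul_set I J (c * x).
Proof.
move=> [s [sP ->]]; exists [seq (c * p.1, p.2) | p <- s]; split.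
  by move=> p /mapP[q /sP[Iq Jq] ->]; split=> //; apply: ideal_M.
by rewrite mulr_sumr big_map; apply: eq_bigr => p _; rewrite mulrA.
Qed.

Definition ideal_mul I J : ideal R :=
  Ideal (@ideal_mul0 I J) (@ideal_mulD I J) (@ideal_mulM I J).

Definition ideal_exp I (n : nat) : ideal R := iter n (ideal_mul I) ideal_top.

Definition ideal_expz I (n : int) : ideal R :=
  if n is Posz k then ideal_exp I k else ideal_top.

Definition powprod I J (r s : nat) : ideal R :=
  ideal_mul (ideal_exp I r) (ideal_exp J s).

Definition powprodz I J (p : int * int) : ideal R :=
  ideal_mul (ideal_expz I p.1) (ideal_expz J p.2).

Definition scale_set (a : R) (S : set R) : set R := [set a * x | x in S].

Definition sum_set (S T : set R) : set R :=
  [set x | exists u v, [/\ S u, T v & x = u + v]].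

Definition colon_set (S : set R) (a : R) : set R := [set x | S (a * x)].

Definition span_set (s : seq R) : set R :=
  [set x | exists c : 'I_(size s) -> R, x = \sum_(i < size s) c i * s`_i].

Definition noetherian : Prop := forall I, exists s : seq R, I = span_set s :> set R.

Definition prime_ideal (p : ideal R) : Prop :=
  ~ p 1 /\ forall x y, p (x * y) -> p x \/ p y.

Definition maximal_ideal m : Prop :=
  ~ m 1 /\ forall I, m `<=` I -> ~ I 1 -> I = m :> set R.

Definition local_ring m : Prop :=
  maximal_ideal m /\ forall n : ideal R, maximal_ideal n -> n = m :> set R.

Definition radical_set (S : set R) : set R := [set x | exists n : nat, S (x ^+ n)].

Definition primary_ideal (q : ideal R) : Prop :=
  ~ q 1 /\ forall x y, q (x * y) -> q x \/ radical_set q y.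

Definition primary_to m (q : ideal R) : Prop := primary_ideal q /\ radical_set q = m.

Definition prime_chain (n : nat) : Prop :=
  exists p : nat -> ideal R, (forall i, (i <= n)%N -> prime_ideal (p i)) /\
    (forall i, (i < n)%N -> (p i : set R) `<` p i.+1).

Definition krull_dim (d : nat) : Prop := is_max_nat prime_chain d.

Definition regular_sequence (s : seq R) : Prop :=
  ~ span_set s 1 /\
  forall i, (i < size s)%N ->
    forall y, span_set (take i s) (s`_i * y) -> span_set (take i s) y.

Definition depth m (d : nat) : Prop :=
  is_max_nat [set n | exists s : seq R,
    [/\ size s = n, (forall x, x \in s -> m x) & regular_sequence s]] d.

Definition cohen_macaulay_local m : Prop :=
  [/\ noetherian, local_ring m & exists d, krull_dim d /\ depth m d].

(* range enumerates the cosets of m, i.e. the elements of R / m. *)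
Definition infinite_residue_field m : Prop :=
  infinite_set (range (fun x : R => [set y | m (y - x)])).

Definition joint_reduction_module_den I J (a b : R) (r s : nat) : set R :=
  sum_set (scale_set a (powprod I J r s.+1)) (scale_set b (powprod I J r.+1 s)).

Definition joint_reduction I J (a b : R) : Prop :=
  [/\ I a, J b & exists N : nat, forall r s : nat, (N <= r)%N -> (N <= s)%N ->
    (powprod I J r.+1 s.+1 : set R) = joint_reduction_module_den I J a b r s].

Definition rees_joint_reduction I J (a b : R) : Prop :=
  [/\ joint_reduction I J a b,
      eventually (fun r => forall s : nat,
        scale_set a setT `&` powprod I J r.+1 s = scale_set a (powprod I J r s))
    & eventually (fun s => forall r : nat,
        scale_set b setT `&` powprod I J r s.+1 = scale_set b (powprod I J r s))].

Definition colength (K : set R) : \bar int := @length R R^o K setT.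

Definition length_M1 I J a b (r s : nat) : \bar int :=
  @length R R^o (joint_reduction_module_den I J a b r s) (powprod I J r.+1 s.+1).

(* The value u n takes for all large n (+oo if u is not eventually constant). *)
Definition eventual_value (u : nat -> \bar int) : \bar int :=
  match pselect (exists v, eventually (fun n => u n = v)) with
  | left h => projT1 (cid h)
  | right _ => +oo%E
  end.

Definition M1_row I J a b (i : nat) : \bar int :=
  eventual_value (fun s => length_M1 I J a b i s).

Definition M1_col I J a b (j : nat) : \bar int :=
  eventual_value (fun r => length_M1 I J a b r j).

Definition joint_ratliff_rush I J (a b : R) (r s : nat) : set R :=
  \bigcup_(k in [set k : nat | (1 <= k)%N])
    (colon_set (powprod I J (r + k) s) (a ^+ k) `&`
     colon_set (powprod I J r (s + k)) (b ^+ k)).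

Definition hilbert_coeffs K (e : nat -> int) : Prop :=
  eventually (fun n => colength (ideal_exp K n) =
    (e 0%N * 'C(n.+1, 2)%:Z - e 1%N * n%:Z + e 2%N)%:E).

Definition bigraded_hilbert_coeffs I J (e : nat -> nat -> int) : Prop :=
  exists N : nat, forall r s : nat, (N <= r)%N -> (N <= s)%N ->
    colength (powprod I J r s) =
      (\sum_(i < 3) \sum_(j < 3 | (i + j <= 2)%N)
         (-1) ^+ (i + j)%N * e i j *
         'C((r + i - 1)%N, i)%:Z * 'C((s + j - 1)%N, j)%:Z)%:E.

(* ell(R / I^r J^s) as a function of s >> 0 for each fixed r, with leading
   coefficient e0 (the multiplicity of J). *)
Definition row_hilbert_coeffs I J (e0 : int) (g1 g2 : nat -> int) : Prop :=
  forall r : nat, eventually (fun s => colength (powprod I J r s) =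
    (e0 * 'C(s.+1, 2)%:Z - g1 r * s%:Z + g2 r)%:E).

(* The same in r >> 0 for each fixed s. *)
Definition col_hilbert_coeffs I J (e0 : int) (h1 h2 : nat -> int) : Prop :=
  forall s : nat, eventually (fun r => colength (powprod I J r s) =
    (e0 * 'C(r.+1, 2)%:Z - h1 s * r%:Z + h2 s)%:E).

End Ideals.

(* Finitely supported functions on the exponents; the ring structure of
   [{malg R[K]}] only covers monoids K without nontrivial units. *)
Definition laurent (R : comNzRingType) := {malg R[(int * int)%type]}.

Section Laurent.
Local Open Scope fset_scope.
Local Open Scope ring_scope.
Variable R : comNzRingType.
Local Notation L := (laurent R).
Local Notation K := (int * int)%type.
Implicit Types (f g h : L) (p q : K).

HB.instance Definition _ := GRing.Lmodule.on L.

Definition laurent_mul f g : L :=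
  \sum_(p <- msupp f) \sum_(q <- msupp g) << f@_p * g@_q *g p + q >>.

Definition laurent_one : L := << 1 *g 0 >>.

Lemma laurent_mulw (d1 d2 : {fset K}) f g :
  msupp f `<=` d1 -> msupp g `<=` d2 ->
  laurent_mul f g =
    \sum_(p <- d1) \sum_(q <- d2) << f@_p * g@_q *g p + q >>.
Proof.
move=> le1 le2; rewrite /laurent_mul (big_fset_incl _ le1) /=.
  apply/eq_bigr=> k1 _; apply/big_fset_incl => // k _ /mcoeff_outdom ->.
  by rewrite mulr0 monalgU0.
move=> k _ /mcoeff_outdom g1k.
by rewrite big1 => // k' _; rewrite g1k mul0r monalgU0.
Qed.

Lemma laurent_mulC : commutative laurent_mul.
Proof.
move=> f g; rewrite /laurent_mul exchange_big.
apply/eq_bigr => p _; apply/eq_bigr => q _.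
by rewrite mulrC [q + p]addrC.
Qed.

Lemma laurent_mul0l : left_zero 0 laurent_mul.
Proof. by move=> g; rewrite /laurent_mul msupp0 big_seq_fset0. Qed.

Lemma laurent_mulUU c1 c2 p q :
  laurent_mul << c1 *g p >> << c2 *g q >> = << c1 * c2 *g p + q >>.
Proof. by rewrite (laurent_mulw msuppU_le msuppU_le) !big_seq_fset1 !mcoeffUU. Qed.

Lemma laurent_mulUl c p g :
  laurent_mul << c *g p >> g = \sum_(q <- msupp g) << c * g@_q *g p + q >>.
Proof.
rewrite (laurent_mulw msuppU_le (fsubset_refl _)) big_seq_fset1.
by apply/eq_bigr => k' _; rewrite mcoeffUU.
Qed.

Lemma laurent_mul1l : left_id laurent_one laurent_mul.
Proof.
move=> g; rewrite laurent_mulUl [RHS]monalgE.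
by apply/eq_bigr => q _; rewrite mul1r add0r.
Qed.

Lemma laurent_mulDl : left_distributive laurent_mul +%R.
Proof.
move=> g1 g2 g.
rewrite [in RHS](laurent_mulw (fsubsetUl _ (msupp g2)) (fsubset_refl _)).
rewrite [in RHS](laurent_mulw (fsubsetUr (msupp g1) _) (fsubset_refl _)).
rewrite (laurent_mulw (msuppD_le _ _) (fsubset_refl _)).
rewrite -big_split /=; apply/eq_bigr=> k1 _.
rewrite -big_split /=; apply/eq_bigr=> k2 _.
by rewrite mcoeffD mulrDl monalgUD.
Qed.

Lemma laurent_mulDr : right_distributive laurent_mul +%R.
Proof. by move=> f g h; rewrite ![laurent_mul f _]laurent_mulC laurent_mulDl. Qed.

Lemma laurent_mul0r : right_zero 0 laurent_mul.
Proof. by move=> f; rewrite laurent_mulC laurent_mul0l. Qed.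

Lemma laurent_mulEl f g :
  laurent_mul f g = \sum_(p <- msupp f) laurent_mul << f@_p *g p >> g.
Proof. by apply/eq_bigr => p _; rewrite laurent_mulUl. Qed.

Lemma laurent_mulEr f g :
  laurent_mul f g = \sum_(q <- msupp g) laurent_mul f << g@_q *g q >>.
Proof.
by rewrite laurent_mulC laurent_mulEl; apply/eq_bigr=> q _; rewrite laurent_mulC.
Qed.

Lemma laurent_mulA : associative laurent_mul.
Proof.
move=> g1 g2 g3.
rewrite [RHS](big_morph (laurent_mul^~ _)
  (fun _ _ => laurent_mulDl _ _ _) (laurent_mul0l _)).
rewrite laurent_mulEl; apply/eq_bigr=> k1 _.
rewrite [LHS](big_morph (laurent_mul _)
  (fun _ _ => laurent_mulDr _ _ _) (laurent_mul0r _)).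
rewrite [RHS](big_morph (laurent_mul^~ _)
  (fun _ _ => laurent_mulDl _ _ _) (laurent_mul0l _)).
apply/eq_bigr=> k2 _.
rewrite [LHS](big_morph (laurent_mul _)
  (fun _ _ => laurent_mulDr _ _ _) (laurent_mul0r _)).
by rewrite laurent_mulEr; apply/eq_bigr=> k3 _; rewrite !laurent_mulUU mulrA addrA.
Qed.

Lemma laurent_one_neq0 : laurent_one != 0.
Proof. by apply/eqP/malgP=> /(_ 0) /eqP; rewrite !mcoeffsE oner_eq0. Qed.

HB.instance Definition _ := GRing.Zmodule_isComNzRing.Build L
  laurent_mulA laurent_mulC laurent_mul1l laurent_mulDl laurent_one_neq0.

Lemma laurent_scaleE (c : R) f : c *: f = laurent_mul << c *g 0 >> f.
Proof.
apply/malgP => p; rewrite laurent_mulUl mcoeffZ raddf_sum /=.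
rewrite {1}[f]monalgE raddf_sum mulr_sumr /=.
by apply/eq_bigr => q _; rewrite add0r !mcoeffU mulrnAr.
Qed.

Lemma laurent_scaleAl (c : R) f g : c *: (f * g) = c *: f * g.
Proof. by rewrite !laurent_scaleE laurent_mulA. Qed.

HB.instance Definition _ := GRing.Lmodule_isLalgebra.Build R L laurent_scaleAl.
HB.instance Definition _ := GRing.Lalgebra_isComAlgebra.Build R L.

Lemma laurent_mcoeffM f g p :
  (f * g)@_p = \sum_(q1 <- msupp f) \sum_(q2 <- msupp g)
    (f@_q1 * g@_q2) *+ (q1 + q2 == p).
Proof.
rewrite raddf_sum /=; apply/eq_bigr=> k1 _; rewrite raddf_sum /=.
by apply/eq_bigr=> k2 _; rewrite mcoeffU.
Qed.

End Laurent.

Section IdealFacts.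
Variable R : comNzRingType.
Implicit Types (I J : ideal R).

Lemma ideal_sum I (T : Type) (s : seq T) (P : pred T) (F : T -> R) :
  (forall i, P i -> I (F i)) -> I (\sum_(i <- s | P i) F i).
Proof.
move=> IF; apply: (big_ind (fun x => I x)); first exact: ideal_0.
  by move=> x y; apply: ideal_D.
exact: IF.
Qed.

Lemma ideal_mul_in I J x y : I x -> J y -> ideal_mul I J (x * y).
Proof.
move=> Ix Jy; exists [:: (x, y)]; rewrite big_seq1; split=> // p.
by rewrite inE => /eqP ->.
Qed.

Lemma ideal_mul_ind I J K :
  (forall x y, I x -> J y -> (K : ideal R) (x * y)) -> ideal_mul I J `<=` K.
Proof.
move=> IJK z [s [sP ->]]; rewrite big_seq; apply: ideal_sum => p /sP[].
exact: IJK.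
Qed.

Lemma ideal_exp_in I m n x y :
  ideal_exp I m x -> ideal_exp I n y -> ideal_exp I (m + n) (x * y).
Proof.
elim: m x y => [|m IHm] x y; first by move=> _; apply: ideal_M.
move=> [s [sP ->]] Iy; rewrite mulr_suml big_seq.
apply: ideal_sum => p /sP[Ip1 Ip2]; rewrite -mulrA addSn.
by apply: ideal_mul_in => //; apply: IHm.
Qed.

Lemma ideal_exp_le I m n x : (m <= n)%N -> ideal_exp I n x -> ideal_exp I m x.
Proof.
move=> /subnK <-; elim: (n - m)%N x => [//|k IHk] x.
rewrite addSn => -[s [sP ->]]; rewrite big_seq.
by apply: ideal_sum => p /sP[_ /IHk]; apply: ideal_M.
Qed.

Lemma ideal_expz_in I (m n : int) x y :
  ideal_expz I m x -> ideal_expz I n y -> ideal_expz I (m + n) (x * y).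
Proof.
have aux (k l : nat) u v : ideal_exp I k u -> ideal_expz I (k%:Z - l%:Z) (v * u).
  case: (leqP l k) => [lk|kl] Iu.
    by rewrite subzn //; apply: ideal_M; apply: ideal_exp_le Iu; rewrite leq_subr.
  have : k%:Z - l%:Z < 0 by rewrite subr_lt0 ltz_nat.
  by case: (k%:Z - l%:Z) => [j|j].
case: m n => [m|m] [n|n] //=; first exact: ideal_exp_in.
  by move=> Ix _; rewrite NegzE mulrC; apply: aux.
by move=> _ Iy; rewrite NegzE addrC; apply: aux.
Qed.

Lemma powprodz_in I J p q x y :
  powprodz I J p x -> powprodz I J q y -> powprodz I J (p + q) (x * y).
Proof.
move=> [s [sP ->]] [t [tP ->]]; rewrite mulr_suml big_seq.
apply: ideal_sum => u /sP[u1 u2]; rewrite mulr_sumr big_seq.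
apply: ideal_sum => v /tP[v1 v2]; rewrite mulrACA.
by apply: ideal_mul_in; apply: ideal_expz_in.
Qed.

Lemma powprodz_top I J p x :
  (p.1 <= 0) -> (p.2 <= 0) -> powprodz I J p x.
Proof.
move=> p1 p2; rewrite -[x]mulr1; apply: ideal_mul_in.
  by case: p.1 p1 => [[|n]|n].
by case: p.2 p2 => [[|n]|n].
Qed.

Lemma ideal_exp1 I a : I a -> ideal_exp I 1 a.
Proof. by move=> Ia; rewrite -[a]mulr1; apply: (@ideal_mul_in I (ideal_top R)). Qed.

End IdealFacts.

Section ExtendedRees.
Variables (R : comNzRingType) (I J : ideal R).

Definition rees_pred : {pred laurent R} :=
  fun f => `[< forall p : int * int, powprodz I J p f@_p >].

Lemma rees_subalg_closed : subalg_closed rees_pred.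
Proof.
split.
- apply/asboolP => p; rewrite mcoeffU; have [<-|_] := eqVneq; last exact: ideal_0.
  exact: powprodz_top.
- move=> c f g /asboolP fP /asboolP gP; apply/asboolP => p.
  by rewrite mcoeffD mcoeffZ; apply: ideal_D => //; apply: ideal_M.
- move=> f g /asboolP fP /asboolP gP; apply/asboolP => p.
  rewrite laurent_mcoeffM; apply: ideal_sum => q1 _; apply: ideal_sum => q2 _.
  have [<-|_] := eqVneq; last exact: ideal_0.
  by rewrite mulr1n; apply: powprodz_in.
Qed.

HB.instance Definition _ :=
  GRing.isSubalgClosed.Build R (laurent R) rees_pred rees_subalg_closed.

(* R' = \bigoplus_(r, s) I^r J^s t1^r t2^s *)
Record ext_rees := ExtRees {
  rees_val : laurent R;
  rees_valP : rees_pred rees_val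
}.

HB.instance Definition _ := [isSub for rees_val].
HB.instance Definition _ := [Choice of ext_rees by <:].
HB.instance Definition _ := [SubChoice_isSubComNzRing of ext_rees by <:].
HB.instance Definition _ := [SubZmodule_isSubLmodule of ext_rees by <:].
HB.instance Definition _ := [SubNzRing_SubLmodule_isSubLalgebra of ext_rees by <:].
HB.instance Definition _ := [SubLalgebra_isSubAlgebra of ext_rees by <:].

Definition rees_homogeneous (p : int * int) (f : ext_rees) : Prop :=
  forall q, q != p -> (rees_val f)@_q = 0.

Lemma rees_monomial_subproof (p : int * int) (u : R) :
  powprodz I J p u -> rees_pred (<< u *g p >> : laurent R).
Proof.
move=> pu; apply/asboolP => q; rewrite mcoeffU.
by have [<-|_] := eqVneq; [rewrite mulr1n | exact: ideal_0].
Qed.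

(* u t1^r t2^s for u in I^r J^s and p = (r, s) *)
Definition rees_monomial (p : int * int) (u : R) (pu : powprodz I J p u) : ext_rees :=
  ExtRees (rees_monomial_subproof pu).

Lemma powprodz10 (a : R) : I a -> powprodz I J (1, 0) a.
Proof.
move=> /ideal_exp1 Ia; rewrite -[a]mulr1.
exact: (@ideal_mul_in _ (ideal_exp I 1) (ideal_exp J 0)).
Qed.

Lemma powprodz01 (b : R) : J b -> powprodz I J (0, 1) b.
Proof.
move=> /ideal_exp1 Jb; rewrite -[b]mul1r.
exact: (@ideal_mul_in _ (ideal_exp I 0) (ideal_exp J 1)).
Qed.

Definition rees_at1 (a : R) (Ia : I a) : ext_rees := rees_monomial (powprodz10 Ia).
Definition rees_bt2 (b : R) (Jb : J b) : ext_rees := rees_monomial (powprodz01 Jb).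

End ExtendedRees.

Section Localization.
Variables (R : comNzRingType) (A : comAlgType R) (x : A).

(* The pair (u, n) stands for the fraction u / x^n. *)
Definition loc_rel : rel (A * nat) := fun y z =>
  `[< exists k : nat, x ^+ k * (x ^+ z.2 * y.1 - x ^+ y.2 * z.1) = 0 >].

Lemma loc_rel_refl : reflexive loc_rel.
Proof. by move=> y; apply/asboolP; exists 0%N; rewrite subrr mulr0. Qed.

Lemma loc_rel_sym : symmetric loc_rel.
Proof.
by move=> y z; apply/asbool_equiv_eq; split=> -[k kP]; exists k;
  rewrite -opprB mulrN kP oppr0.
Qed.

Lemma loc_rel_trans : transitive loc_rel.
Proof.
move=> [v n] [u m] [w l] /asboolP[/= k kP] /asboolP[/= j jP]; apply/asboolP.
exists (k + j + n)%N => /=; rewrite !exprD.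
have -> : x ^+ k * x ^+ j * x ^+ n * (x ^+ l * u - x ^+ m * w) =
  x ^+ j * x ^+ l * (x ^+ k * (x ^+ n * u - x ^+ m * v)) +
  x ^+ k * x ^+ m * (x ^+ j * (x ^+ l * v - x ^+ n * w)) by ring.
by rewrite kP jP !mulr0 addr0.
Qed.

Canonical loc_equiv := EquivRel loc_rel loc_rel_refl loc_rel_sym loc_rel_trans.

Definition loc := {eq_quot loc_equiv}.

HB.instance Definition _ : EqQuotient _ loc_equiv loc := EqQuotient.on loc.
HB.instance Definition _ := Choice.on loc.

Definition frac (u : A) (n : nat) : loc := \pi_loc (u, n).

Lemma frac_eqP u m v n :
  frac u m = frac v n <-> exists k, x ^+ k * (x ^+ n * u - x ^+ m * v) = 0.
Proof. by split=> [/eqmodP/asboolP//|uv]; apply/eqmodP/asboolP. Qed.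

Lemma frac_surj (z : loc) : frac (repr z).1 (repr z).2 = z.
Proof. by rewrite /frac -surjective_pairing reprK. Qed.

Lemma loc_ind (P : loc -> Prop) : (forall u n, P (frac u n)) -> forall z, P z.
Proof. by move=> Pf z; rewrite -[z]frac_surj. Qed.

Definition loc_add (y z : loc) : loc :=
  frac (x ^+ (repr z).2 * (repr y).1 + x ^+ (repr y).2 * (repr z).1)
       ((repr y).2 + (repr z).2)%N.
Definition loc_opp (y : loc) : loc := frac (- (repr y).1) (repr y).2.
Definition loc_scale (c : R) (y : loc) : loc := frac (c *: (repr y).1) (repr y).2.

Lemma loc_addE u m v n :
  loc_add (frac u m) (frac v n) = frac (x ^+ n * u + x ^+ m * v) (m + n).
Proof.
have /frac_eqP := frac_surj (frac u m); have /frac_eqP := frac_surj (frac v n).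
rewrite /loc_add; case: (repr (frac u m)) (repr (frac v n)) => [u' m'] [v' n'] /=.
move=> [j jP] [k kP]; apply/frac_eqP; exists (k + j)%N; rewrite !exprD.
have -> : x ^+ k * x ^+ j * (x ^+ m * x ^+ n * (x ^+ n' * u' + x ^+ m' * v') -
     x ^+ m' * x ^+ n' * (x ^+ n * u + x ^+ m * v)) =
  x ^+ j * x ^+ n * x ^+ n' * (x ^+ k * (x ^+ m * u' - x ^+ m' * u)) +
  x ^+ k * x ^+ m * x ^+ m' * (x ^+ j * (x ^+ n * v' - x ^+ n' * v)) by ring.
by rewrite kP jP !mulr0 addr0.
Qed.

Lemma loc_oppE u m : loc_opp (frac u m) = frac (- u) m.
Proof.
apply/frac_eqP; have /frac_eqP[k kP] := frac_surj (frac u m).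
by exists k; rewrite !mulrN -opprD mulrN kP oppr0.
Qed.

Lemma loc_scaleE c u m : loc_scale c (frac u m) = frac (c *: u) m.
Proof.
apply/frac_eqP; have /frac_eqP[k kP] := frac_surj (frac u m).
by exists k; rewrite -!scalerAr -scalerBr -scalerAr kP scaler0.
Qed.

Lemma loc_addA : associative loc_add.
Proof.
elim/loc_ind => u m; elim/loc_ind => v n; elim/loc_ind => w l.
by rewrite !loc_addE; congr frac; rewrite ?addnA // !exprD; ring.
Qed.

Lemma loc_addC : commutative loc_add.
Proof.
elim/loc_ind => u m; elim/loc_ind => v n.
by rewrite !loc_addE addrC addnC.
Qed.

Lemma loc_add0 : left_id (frac 0 0) loc_add.
Proof. by elim/loc_ind => u m; rewrite loc_addE mulr0 add0r expr0 mul1r. Qed.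

Lemma loc_addN : left_inverse (frac 0 0) loc_opp loc_add.
Proof.
elim/loc_ind => u m; rewrite loc_oppE loc_addE mulrN addNr.
by apply/frac_eqP; exists 0%N; rewrite !mulr0 subrr mulr0.
Qed.

HB.instance Definition _ := GRing.isZmodule.Build loc loc_addA loc_addC loc_add0 loc_addN.

Lemma loc_scaleA c d z : loc_scale c (loc_scale d z) = loc_scale (c * d) z.
Proof. by elim/loc_ind: z => u m; rewrite !loc_scaleE scalerA. Qed.

Lemma loc_scale1 : left_id 1 loc_scale.
Proof. by elim/loc_ind => u m; rewrite loc_scaleE scale1r. Qed.

Lemma loc_scaleDr : right_distributive loc_scale +%R.
Proof.
move=> c; elim/loc_ind => u m; elim/loc_ind => v n.
rewrite [_ + frac _ _]loc_addE !loc_scaleE [RHS]loc_addE.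
by rewrite scalerDr !scalerAr.
Qed.

Lemma loc_scaleDl z : {morph loc_scale^~ z : c d / c + d}.
Proof.
move=> c d; elim/loc_ind: z => u m.
rewrite !loc_scaleE [RHS]loc_addE; apply/frac_eqP; exists 0%N.
by rewrite scalerDl exprD; ring.
Qed.

HB.instance Definition _ := GRing.Zmodule_isLmodule.Build R loc
  loc_scaleA loc_scale1 loc_scaleDr loc_scaleDl.

Lemma fracD u m v n : frac u m + frac v n = frac (x ^+ n * u + x ^+ m * v) (m + n).
Proof. exact: loc_addE. Qed.

Lemma fracZ c u m : c *: frac u m = frac (c *: u) m.
Proof. exact: loc_scaleE. Qed.

Lemma fracN u m : - frac u m = frac (- u) m.
Proof. exact: loc_oppE. Qed.

Lemma frac0 : 0 = frac 0 0.
Proof. by []. Qed.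

End Localization.

Section Quotient.
Variables (R : nzRingType) (V : lmodType R) (N : set V) (subN : is_submodule N).

Let N0 : N 0. Proof. by case: subN. Qed.
Let ND u v : N u -> N v -> N (u + v). Proof. by case: subN => _ + _; apply. Qed.
Let NZ c u : N u -> N (c *: u). Proof. by case: subN => _ _; apply. Qed.
Let NN u : N u -> N (- u). Proof. by rewrite -scaleN1r; apply: NZ. Qed.

Definition quot_rel of is_submodule N : rel V := fun u v => `[< N (u - v) >].

Lemma quot_rel_refl : reflexive (quot_rel subN).
Proof. by move=> u; apply/asboolP; rewrite subrr. Qed.

Lemma quot_rel_sym : symmetric (quot_rel subN).
Proof.
by move=> u v; apply/asbool_equiv_eq; split=> /NN; rewrite opprB.
Qed.

Lemma quot_rel_trans : transitive (quot_rel subN).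
Proof.
move=> v u w /asboolP uv /asboolP vw; apply/asboolP.
by rewrite -[u](subrK v) -addrA; apply: ND.
Qed.

Canonical quot_equiv := EquivRel (quot_rel subN) quot_rel_refl quot_rel_sym quot_rel_trans.

Definition quotmod := {eq_quot quot_equiv}.

HB.instance Definition _ : EqQuotient _ quot_equiv quotmod := EqQuotient.on quotmod.
HB.instance Definition _ := Choice.on quotmod.

Definition quot_class (u : V) : quotmod := \pi_quotmod u.

Lemma quot_class_eqP u v : quot_class u = quot_class v <-> N (u - v).
Proof. by split=> [/eqmodP/asboolP//|uv]; apply/eqmodP/asboolP. Qed.

Lemma quot_ind (P : quotmod -> Prop) : (forall u, P (quot_class u)) -> forall z, P z.
Proof. by move=> Pc z; rewrite -[z]reprK. Qed.

Definition quot_add (y z : quotmod) := quot_class (repr y + repr z).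
Definition quot_opp (y : quotmod) := quot_class (- repr y).
Definition quot_scale (c : R) (y : quotmod) := quot_class (c *: repr y).

Let reprN u : N (repr (quot_class u) - u).
Proof. by apply/quot_class_eqP; rewrite /quot_class reprK. Qed.

Lemma quot_addE u v : quot_add (quot_class u) (quot_class v) = quot_class (u + v).
Proof. by apply/quot_class_eqP; rewrite opprD addrACA; apply: ND. Qed.

Lemma quot_oppE u : quot_opp (quot_class u) = quot_class (- u).
Proof. by apply/quot_class_eqP; rewrite -opprD; apply: NN. Qed.

Lemma quot_scaleE c u : quot_scale c (quot_class u) = quot_class (c *: u).
Proof. by apply/quot_class_eqP; rewrite -scalerBr; apply: NZ. Qed.

Lemma quot_addA : associative quot_add.
Proof. by do 3!elim/quot_ind => ?; rewrite !quot_addE addrA. Qed.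

Lemma quot_addC : commutative quot_add.
Proof. by do 2!elim/quot_ind => ?; rewrite !quot_addE addrC. Qed.

Lemma quot_add0 : left_id (quot_class 0) quot_add.
Proof. by elim/quot_ind => ?; rewrite !quot_addE add0r. Qed.

Lemma quot_addN : left_inverse (quot_class 0) quot_opp quot_add.
Proof. by elim/quot_ind => ?; rewrite quot_oppE quot_addE addNr. Qed.

HB.instance Definition _ :=
  GRing.isZmodule.Build quotmod quot_addA quot_addC quot_add0 quot_addN.

Lemma quot_scaleA c d z : quot_scale c (quot_scale d z) = quot_scale (c * d) z.
Proof. by elim/quot_ind: z => u; rewrite !quot_scaleE scalerA. Qed.

Lemma quot_scale1 : left_id 1 quot_scale.
Proof. by elim/quot_ind => u; rewrite quot_scaleE scale1r. Qed.

Lemma quot_scaleDr : right_distributive quot_scale +%R.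
Proof.
move=> c; elim/quot_ind => u; elim/quot_ind => v.
by rewrite [_ + quot_class _]quot_addE !quot_scaleE [RHS]quot_addE scalerDr.
Qed.

Lemma quot_scaleDl z : {morph quot_scale^~ z : c d / c + d}.
Proof.
move=> c d; elim/quot_ind: z => u.
by rewrite !quot_scaleE [RHS]quot_addE scalerDl.
Qed.

HB.instance Definition _ := GRing.Zmodule_isLmodule.Build R quotmod
  quot_scaleA quot_scale1 quot_scaleDr quot_scaleDl.

Lemma quot_classD u v : quot_class (u + v) = quot_class u + quot_class v.
Proof. by rewrite [RHS]quot_addE. Qed.

Lemma quot_classZ c u : quot_class (c *: u) = c *: quot_class u.
Proof. by rewrite [RHS]quot_scaleE. Qed.

End Quotient.

(* The Cech complex 0 -> A -> A_x (+) A_y -> A_(xy) -> 0 of A on x, y: its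
   cohomology at A_(xy) is H^2_(x, y)(A). *)
Section Cech.
Variables (R : comNzRingType) (A : comAlgType R) (x y : A).

(* A_x -> A_(xy) and A_y -> A_(xy); these maps do not depend on the fraction
   chosen to represent the argument (lemmas below). *)
Definition cech_from_x (z : loc x) : loc (x * y) :=
  frac (x * y) (y ^+ (repr z).2 * (repr z).1) (repr z).2.
Definition cech_from_y (z : loc y) : loc (x * y) :=
  frac (x * y) (x ^+ (repr z).2 * (repr z).1) (repr z).2.

Lemma cech_from_xE u n :
  cech_from_x (frac x u n) = frac (x * y) (y ^+ n * u) n.
Proof.
have /frac_eqP := frac_surj (frac x u n); rewrite /cech_from_x.
case: (repr (frac x u n)) => [u' n'] /= [k kP].
apply/frac_eqP; exists k; rewrite !exprMn.
have -> : x ^+ k * y ^+ k * (x ^+ n * y ^+ n * (y ^+ n' * u') -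
    x ^+ n' * y ^+ n' * (y ^+ n * u)) =
  y ^+ k * y ^+ n * y ^+ n' * (x ^+ k * (x ^+ n * u' - x ^+ n' * u)) by ring.
by rewrite kP mulr0.
Qed.

Lemma cech_from_yE u n :
  cech_from_y (frac y u n) = frac (x * y) (x ^+ n * u) n.
Proof.
have /frac_eqP := frac_surj (frac y u n); rewrite /cech_from_y.
case: (repr (frac y u n)) => [u' n'] /= [k kP].
apply/frac_eqP; exists k; rewrite !exprMn.
have -> : x ^+ k * y ^+ k * (x ^+ n * y ^+ n * (x ^+ n' * u') -
    x ^+ n' * y ^+ n' * (x ^+ n * u)) =
  x ^+ k * x ^+ n * x ^+ n' * (y ^+ k * (y ^+ n * u' - y ^+ n' * u)) by ring.
by rewrite kP mulr0.
Qed.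

Lemma cech_from_x_linear : linear cech_from_x.
Proof.
move=> c; elim/loc_ind => u m; elim/loc_ind => v n.
rewrite fracZ fracD !cech_from_xE fracZ fracD scalerAr; congr frac.
by move: (c *: u) => cu; rewrite !exprMn exprD; ring.
Qed.

Lemma cech_from_y_linear : linear cech_from_y.
Proof.
move=> c; elim/loc_ind => u m; elim/loc_ind => v n.
rewrite fracZ fracD !cech_from_yE fracZ fracD scalerAr; congr frac.
by move: (c *: u) => cu; rewrite !exprMn exprD; ring.
Qed.

Definition cech_d1 (w : loc x * loc y) : loc (x * y) :=
  cech_from_y w.2 - cech_from_x w.1.

Lemma cech_d1_linear : linear cech_d1.
Proof.
move=> c [z1 z2] [w1 w2]; rewrite /cech_d1 /= cech_from_x_linear cech_from_y_linear.
by rewrite scalerBr opprD addrACA.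
Qed.

Lemma cech_d1_image_submodule : is_submodule (range cech_d1).
Proof.
split.
- by exists 0 => //; have := cech_d1_linear (-1) 0 0; rewrite !scaleN1r !addNr.
- move=> _ _ [z _ <-] [w _ <-]; exists (z + w) => //.
  by have := cech_d1_linear 1 z w; rewrite !scale1r.
- move=> c _ [z _ <-]; exists (c *: z) => //.
  have d0 : cech_d1 0 = 0.
    by have := cech_d1_linear (-1) 0 0; rewrite !scaleN1r !addNr.
  by have := cech_d1_linear c z 0; rewrite d0 !addr0.
Qed.

Definition local_cohomology2 := quotmod cech_d1_image_submodule.

HB.instance Definition _ := GRing.Lmodule.on local_cohomology2.

End Cech.

Section ReesCohomology.
Variables (R : comNzRingType) (I J : ideal R) (a b : R) (Ia : I a) (Jb : J b).

Definition rees_H2 := local_cohomology2 (rees_at1 J Ia) (rees_bt2 I Jb).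

HB.instance Definition _ := GRing.Lmodule.on rees_H2.

(* [R'_(a t1 b t2)]_(r, s): the fractions f / (a t1 b t2)^n with f homogeneous
   of degree (r + n, s + n). *)
Definition rees_loc_component (r s : int) : set (loc (rees_at1 J Ia * rees_bt2 I Jb)) :=
  [set z | exists (f : ext_rees I J) (n : nat),
     rees_homogeneous (r + n%:Z, s + n%:Z) f /\
     z = frac (rees_at1 J Ia * rees_bt2 I Jb) f n].

(* [H^2_(a t1, b t2)(R')]_(r, s), an R-submodule of H^2 *)
Definition rees_H2_component (r s : int) : set rees_H2 :=
  quot_class (cech_d1_image_submodule (rees_at1 J Ia) (rees_bt2 I Jb))
    @` rees_loc_component r s.

Definition length_H2 (r s : int) : \bar int :=
  length [set 0 : rees_H2] (rees_H2_component r s).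

End ReesCohomology.

(* Main.v *)
(** The component [H^2_(r, s)] is the direct limit, under multiplication by [ab], of
    the modules [D_k = I^(r+k) J^(s+k) / (a^k I^r J^(s+k) + b^k I^(r+k) J^s)]. The
    Rees property makes the transition maps injective for large [k], so that the
    length of [H^2_(r, s)] is the supremum of the lengths of the [D_k].

    As [R] is Cohen-Macaulay, [a, b] is a regular sequence in both orders, and the
    Koszul relations give
    [l(D_k) = k^2 l(R/(a,b)) + l(R/I^r J^(s+k)) + l(R/I^(r+k) J^s)
              - l(R/I^(r+k) J^(s+k)) - l(R/F)]
    where [F] is the joint Ratliff-Rush closure and [k] is large. Inserting the
    Hilbert polynomials, this is linear in [k], with slope
    [(e_01 - g_1(r) - r e_11) + (e_10 - h_1(s) - s e_11)].

    The same formula with [k = 1], where now [(I^r J^(s+1) : b) = I^r J^s] for large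
    [s], gives [l(M^1_(r,s)) = e_11 + g_1(r+1) - g_1(r)]. Hence [g_1(r) + r e_11] is
    nondecreasing in [r], its limit is [e_01], and it equals [e_01] at [r] exactly
    when [l(M^1_(i,s)) = 0] for large [s], for all [i >= r]. So both summands of the
    slope are nonnegative, and the slope vanishes exactly when (b), equivalently (c), holds;
    the constant term is then the stated length. *)

Require Import Defs.
From mathcomp Require Import all_boot all_order all_algebra.
From mathcomp Require Import monalg.
From mathcomp Require Import boolp classical_sets constructive_ereal.
From mathcomp Require Import zify ring lra.

Set Implicit Arguments.
Unset Strict Implicit.
Unset Printing Implicit Defensive.

Import Order.TTheory GRing.Theory Num.Theory.

Local Open Scope classical_set_scope.
Local Open Scope ring_scope.

(** * Length *)

Lemma is_max_nat_uniq (P : set nat) m n : is_max_nat P m -> is_max_nat P n -> m = n.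
Proof. by move=> [Pm mP] [Pn nP]; apply/eqP; rewrite eqn_leq nP // mP. Qed.

Lemma is_max_nat_exists (P : set nat) m n :
  P m -> (forall k, P k -> (k <= n)%N) -> exists k, is_max_nat P k.
Proof.
move=> Pm nP.
have exP : exists k, `[< P k >] by exists m; apply/asboolP.
have ubP k : `[< P k >] -> (k <= n)%N by move/asboolP/nP.
have [k /asboolP Pk kP] := ex_maxnP exP ubP.
by exists k; split=> // j Pj; apply/kP/asboolP.
Qed.

Section LengthTheory.
Variables (R : nzRingType) (V : lmodType R).
Implicit Types N L M X Y : set V.

Lemma submoduleN N u : is_submodule N -> N u -> N (- u).
Proof. by move=> [_ _ NZ] Nu; rewrite -scaleN1r; apply: NZ. Qed.

Lemma submoduleB N u v : is_submodule N -> N u -> N v -> N (u - v).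
Proof. by move=> sN Nu Nv; case: (sN) => _ ND _; apply: ND => //; apply: submoduleN. Qed.

Lemma submoduleI N M : is_submodule N -> is_submodule M -> is_submodule (N `&` M).
Proof.
move=> [N0 ND NZ] [M0 MD MZ]; split=> //.
  by move=> u v [? ?] [? ?]; split; [apply: ND|apply: MD].
by move=> c u [? ?]; split; [apply: NZ|apply: MZ].
Qed.

Definition submodule_add N M : set V := [set x | exists u v, [/\ N u, M v & x = u + v]].

Lemma submodule_addP N M :
  is_submodule N -> is_submodule M -> is_submodule (submodule_add N M).
Proof.
move=> [N0 ND NZ] [M0 MD MZ]; split.
- by exists 0, 0; rewrite addr0.
- move=> _ _ [u [v [Nu Mv ->]]] [u' [v' [Nu' Mv' ->]]].
  by exists (u + u'), (v + v'); split; [apply: ND|apply: MD|rewrite addrACA].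
- move=> c _ [u [v [Nu Mv ->]]]; exists (c *: u), (c *: v).
  by split; [apply: NZ|apply: MZ|rewrite scalerDr].
Qed.

Lemma submodule_addl N M : is_submodule M -> N `<=` submodule_add N M.
Proof. by move=> [M0 _ _] x Nx; exists x, 0; rewrite addr0. Qed.

Lemma submodule_addr N M : is_submodule N -> M `<=` submodule_add N M.
Proof. by move=> [N0 _ _] x Mx; exists 0, x; rewrite add0r. Qed.

Lemma submodule_add_sub N M X :
  is_submodule X -> N `<=` X -> M `<=` X -> submodule_add N M `<=` X.
Proof. by move=> [_ XD _] NX MX _ [u [v [/NX ? /MX ? ->]]]; apply: XD. Qed.

Lemma chain_between_sub N N' M M' n :
  N' `<=` N -> M `<=` M' -> chain_between N M n -> chain_between N' M' n.
Proof.
move=> N'N MM' [C [CP Clt]]; exists C; split=> // i /CP[sC NC CM].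
by split=> //; apply: subset_trans; eassumption.
Qed.

Lemma chain_between0 N M : is_submodule N -> N `<=` M -> chain_between N M 0.
Proof. by move=> sN NM; exists (fun=> N); split=> // i _; split. Qed.

Lemma chain_between_rcons N X Y n : is_submodule Y -> X `<` Y ->
  chain_between N X n -> chain_between N Y n.+1.
Proof.
move=> sY [XY YX] [C [CP Clt]].
exists (fun i => if (i <= n)%N then C i else Y); split=> i.
  case: (leqP i n) => [/CP[sC NC CX] _|ni _]; first by split=> //; apply: subset_trans XY.
  split=> //; have [_ NC CX] := CP n (leqnn n).
  by apply: subset_trans NC (subset_trans CX XY).
rewrite ltnS => le_in; rewrite le_in; case: (leqP i.+1 n) => [/Clt //|ni].
have -> : i = n by apply/eqP; rewrite eqn_leq le_in.
have [_ _ CX] := CP n (leqnn n).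
split; first exact: subset_trans CX XY.
by move=> YC; apply: YX; apply: subset_trans YC CX.
Qed.

(* A step of a chain is strict after intersecting with L or after adding L, by
   the modular law. *)
Lemma chain_between_modular N L M n :
  is_submodule N -> is_submodule L -> N `<=` L -> L `<=` M ->
  is_submodule M -> chain_between N M n ->
  exists i j, [/\ chain_between N L i, chain_between L M j & n = (i + j)%N].
Proof.
move=> sN sL NL LM sM [C [CP Clt]].
suff aux k : (k <= n)%N -> exists i j, [/\ chain_between N (C k `&` L) i,
    chain_between L (submodule_add (C k) L) j & k = (i + j)%N].
  have [i [j [ci cj ->]]] := aux n (leqnn n).
  exists i, j; split=> //; first by apply: chain_between_sub ci => // x [].
  have [_ _ CM] := CP n (leqnn n).
  by apply: chain_between_sub cj => //; apply: submodule_add_sub.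
elim: k => [|k IHk] kn.
  have [sC NC CM] := CP 0%N kn; exists 0%N, 0%N.
  split=> //; first by apply: chain_between0 => // x Nx; split; [apply: NC|apply: NL].
  by apply: chain_between0 => //; apply: submodule_addr.
have [i [j [ci cj kij]]] := IHk (ltnW kn).
have [sC NC CM] := CP k (ltnW kn); have [sC' NC' CM'] := CP _ kn.
have [CC' nCC'] := Clt k kn.
have sub1 : C k `&` L `<=` C k.+1 `&` L by move=> x [/CC' ? ?].
have sub2 : submodule_add (C k) L `<=` submodule_add (C k.+1) L.
  by move=> _ [u [v [/CC' ? ? ->]]]; exists u, v.
have [eqI|neqI] := pselect (C k.+1 `&` L `<=` C k `&` L); last first.
  exists i.+1, j; split; last by rewrite kij.
    by apply: chain_between_rcons ci => //; apply: submoduleI.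
  exact: chain_between_sub cj.
exists i, j.+1; split; last (by rewrite addnS kij); first exact: chain_between_sub ci.
apply: chain_between_rcons cj; first exact: submodule_addP.
split=> // le; apply: nCC' => x C'x.
have [u [v [Cu Lv xE]]] := le x (submodule_addl sL C'x).
have [_ CD _] := sC; rewrite xE; apply: CD => //.
have [|//] := eqI v; split=> //.
have -> : v = x - u by rewrite xE addrC addKr.
by apply: submoduleB => //; apply: CC'.
Qed.

Lemma chain_between_cat N L M i j :
  is_submodule N -> N `<=` L -> L `<=` M ->
  chain_between N L i -> chain_between L M j -> chain_between N M (i + j).
Proof.
move=> sN NL LM ci [C [CP Clt]].
have [sC0 LC0 _] := CP 0%N isT.
suff aux k : (k <= j)%N -> chain_between N (C k) (i + k).
  by apply: chain_between_sub (aux j (leqnn j)) => //; have [] := CP j (leqnn j).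
elim: k => [_|k IHk kj]; first by rewrite addn0; apply: chain_between_sub ci.
have [sC _ _] := CP _ kj; rewrite addnS.
by apply: chain_between_rcons (IHk (ltnW kj)) => //; apply: Clt.
Qed.

Lemma length_max N M n : is_max_nat (chain_between N M) n -> length N M = n%:Z%:E.
Proof.
move=> maxn; rewrite /length; case: pselect => [h|[]]; last by exists n.
by congr (_%:Z%:E); apply: is_max_nat_uniq maxn; case: (cid h).
Qed.

Lemma length_finP N M x : length N M = x%:E ->
  exists2 n : nat, x = n%:Z & is_max_nat (chain_between N M) n.
Proof.
by rewrite /length; case: pselect => // h [<-]; case: (cid h) => n /=; exists n.
Qed.

Lemma length_ge0 N M x : length N M = x%:E -> 0 <= x.
Proof. by move=> /length_finP[n -> _]. Qed.

Lemma length_finVoo N M : (exists x, length N M = x%:E) \/ length N M = +oo%E.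
Proof. by rewrite /length; case: pselect => [h|_]; [left; eexists|right]. Qed.

(** Concatenating two longest chains gives one inequality; the other is the modular splitting of an
    arbitrary chain. *)
Lemma length_add N L M x y :
  is_submodule N -> is_submodule L -> is_submodule M -> N `<=` L -> L `<=` M ->
  length N L = x%:E -> length L M = y%:E -> length N M = (x + y)%:E.
Proof.
move=> sN sL sM NL LM /length_finP[p -> [cp maxp]] /length_finP[q -> [cq maxq]].
rewrite -PoszD; apply: length_max; split; first exact: chain_between_cat cq.
move=> k /(chain_between_modular sN sL NL LM sM)[i [j [/maxp ip /maxq jq ->]]].
exact: leq_add.
Qed.

(** A chain in either layer is also a chain from [N] to [M], so its length is bounded and a maximum
    exists. *)
Lemma length_split N L M z :
  is_submodule N -> is_submodule L -> is_submodule M -> N `<=` L -> L `<=` M ->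
  length N M = z%:E ->
  exists x y, [/\ length N L = x%:E, length L M = y%:E & z = x + y].
Proof.
move=> sN sL sM NL LM lenz; have /length_finP[n _ [cn maxn]] := lenz.
have [||p maxp] := @is_max_nat_exists (chain_between N L) 0%N n.
- exact: chain_between0.
- by move=> k ck; apply: maxn; apply: chain_between_sub ck.
have [||q maxq] := @is_max_nat_exists (chain_between L M) 0%N n.
- exact: chain_between0.
- by move=> k ck; apply: maxn; apply: chain_between_sub ck.
exists p%:Z, q%:Z; rewrite !(length_max maxp, length_max maxq); split=> //.
have := length_add sN sL sM NL LM (length_max maxp) (length_max maxq).
by rewrite lenz => -[].
Qed.

Lemma lengthxx N : is_submodule N -> length N N = 0%:E.
Proof.
move=> sN; apply: (@length_max _ _ 0); split; first exact: chain_between0.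
case=> // k [C [CP Clt]]; have [_ []] := Clt 0%N isT.
have [_ _ CN] := CP 1%N isT; have [_ NC _] := CP 0%N isT.
exact: subset_trans CN NC.
Qed.

Lemma length0_sub N M : is_submodule N -> is_submodule M -> N `<=` M ->
  length N M = 0%:E -> M `<=` N.
Proof.
move=> sN sM NM /length_finP[n /eqP]; rewrite eqz_nat => /eqP <- [_ max0].
apply: contrapT => nMN; have /max0 // : chain_between N M 1.
by apply: chain_between_rcons (chain_between0 sN (@subset_refl _ N)).
Qed.

End LengthTheory.

(* Linearity is only asked on M because [rees_mono] below is additive only on I^r J^s. *)
Lemma length_morph (R : nzRingType) (V W : lmodType R) (f : V -> W)
    (N M : set V) (N' M' : set W) :
  is_submodule N -> is_submodule M -> N `<=` M ->
  is_submodule N' -> is_submodule M' -> N' `<=` M' ->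
  (forall u v, M u -> M v -> f (u + v) = f u + f v) ->
  (forall c u, M u -> f (c *: u) = c *: f u) ->
  (forall u, M u -> M' (f u)) ->
  (forall w, M' w -> exists2 u, M u & N' (w - f u)) ->
  (forall u, M u -> N' (f u) <-> N u) ->
  length N M = length N' M'.
Proof.
move=> sN sM NM sN' sM' NM' fD fZ fM fsurj fN.
have N'N w : N' w -> N' (- w) by apply: submoduleN.
have N'D v w : N' v -> N' w -> N' (v + w) by case: sN' => _ + _; apply.
have M'D v w : M' v -> M' w -> M' (v + w) by case: sM' => _ + _; apply.
have fB u v : M u -> M v -> f (u - v) = f u - f v.
  move=> Mu Mv; rewrite fD //; last exact: submoduleN.
  by rewrite -scaleN1r fZ // scaleN1r.
have f0 : f 0 = 0 by rewrite -(scale0r 0) fZ ?scale0r //; case: sM.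
rewrite /length; suff -> : chain_between N M = chain_between N' M' by [].
apply/funext => n; apply/propext; split=> -[C [CP Clt]].
(* A chain between [N] and [M] is pushed forward to [f (C i) + N']; conversely a chain between [N']
   and [M'] is pulled back to preimages in [M]. *)
- exists (fun i => [set w | exists2 u, C i u & N' (w - f u)]); split=> i.
    move=> /CP[[C0 CD CZ] NC CM]; split.
    + split; first by exists 0; rewrite // f0 subr0; case: sN'.
      * move=> v w [u Cu vu] [u' Cu' wu']; exists (u + u'); first exact: CD.
        by rewrite fD; [rewrite opprD addrACA; apply: N'D|apply: CM|apply: CM].
      * move=> c w [u Cu wu]; exists (c *: u); first exact: CZ.
        by rewrite fZ -?scalerBr; [case: sN' => _ _; apply|apply: CM].
    + by move=> w N'w; exists 0; rewrite // f0 subr0.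
    + move=> w [u Cu wu]; rewrite -[w](subrK (f u)); apply: M'D.
        exact: NM'.
      exact/fM/CM.
  move=> i_n; have [sC NC CM] := CP i (ltnW i_n).
  have [sC' NC' CM'] := CP _ i_n; have [CC' nCC'] := Clt i i_n.
  split=> [w [u /CC' Cu wu]|sub]; first by exists u.
  apply: nCC' => u Cu.
  have [|v Cv fuv] := sub (f u); first by exists u; rewrite // subrr; case: sN'.
  rewrite -[u](subrK v); have [_ CD _] := sC; apply: CD => //; apply/NC.
  move: fuv; rewrite -fB; [|exact: CM'|exact: CM].
  by apply: iffLR; apply: fN; apply: submoduleB => //; [apply: CM'|apply: CM].
- exists (fun i => M `&` f @^-1` C i); split=> i.
    move=> /CP[[C0 CD CZ] NC CM]; split.
    + split; first by split; [case: sM|apply/NC/fN; [case: sM|case: sN]].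
      * move=> u v [Mu Cu] [Mv Cv]; split; first by case: sM => _ + _; apply.
        by rewrite /= fD //; apply: CD.
      * move=> c u [Mu Cu]; split; first by case: sM => _ _; apply.
        by rewrite /= fZ //; apply: CZ.
    + by move=> u Nu; split; [apply: NM|apply/NC/fN => //; apply: NM].
    + by move=> u [].
  move=> i_n; have [sC NC CM] := CP i (ltnW i_n).
  have [sC' NC' CM'] := CP _ i_n; have [CC' nCC'] := Clt i i_n.
  split=> [u [Mu /CC' Cu]|sub]; first by split.
  apply: nCC' => w Cw; have [u Mu wu] := fsurj _ (CM' _ Cw).
  have Cwu := NC _ wu; have [_ CD _] := sC; rewrite -[w](subrK (f u)); apply: CD => //.
  apply: (proj2 (sub u _)); split=> //=; have -> : f u = w - (w - f u) by rewrite subKr.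
  by apply: submoduleB => //; apply: CC'.
Qed.

(** * Regular pairs *)

Section IdealLengths.
Variable R : comNzRingType.
Implicit Types (I J K : ideal R) (S T A B : set R) (a b c d u v x y : R).

Local Notation is_ideal := (@is_submodule R R^o).

Lemma ideal_submodule I : is_ideal I.
Proof. split; [exact: (@ideal_0 R I)|exact: (@ideal_D R I)|exact: (@ideal_M R I)]. Qed.

Definition ideal_of S (sS : is_ideal S) : ideal R :=
  let: And3 S0 SD SM := sS in @Ideal R S S0 SD SM.

Lemma ideal_ofE S (sS : is_ideal S) : ideal_of sS = S :> set R.
Proof. by case: sS. Qed.

Lemma is_idealT : is_ideal setT. Proof. by []. Qed.

Lemma is_idealM S c x : is_ideal S -> S x -> S (c * x).
Proof. by case=> _ _; apply. Qed.

Lemma is_idealD S x y : is_ideal S -> S x -> S y -> S (x + y).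
Proof. by case=> _ + _; apply. Qed.

Lemma scale_set_ideal c S : is_ideal S -> is_ideal (scale_set c S).
Proof.
move=> [S0 SD SM]; split; first by exists 0; rewrite ?mulr0.
  by move=> _ _ [x Sx <-] [y Sy <-]; exists (x + y); rewrite ?mulrDr //; apply: SD.
by move=> d _ [x Sx <-]; exists (d * x); [apply: SM|rewrite mulrCA].
Qed.

Lemma sum_set_ideal S T : is_ideal S -> is_ideal T -> is_ideal (sum_set S T).
Proof. exact: (@submodule_addP R R^o). Qed.

Lemma colon_set_ideal c S : is_ideal S -> is_ideal (colon_set S c).
Proof.
move=> [S0 SD SM]; split; rewrite /colon_set /=.
- by rewrite mulr0.
- by move=> x y Sx Sy; rewrite mulrDr; apply: SD.
- by move=> d x Sx; rewrite [d *: x]/(d * x) mulrCA; apply: SM.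
Qed.

Lemma setI_ideal S T : is_ideal S -> is_ideal T -> is_ideal (S `&` T).
Proof. exact: (@submoduleI R R^o). Qed.

Lemma bigcup_ideal (F : nat -> set R) : (forall k, is_ideal (F k)) ->
  (forall k l, (k <= l)%N -> F k `<=` F l) -> is_ideal (\bigcup_k F k).
Proof.
move=> sF Fle; split; first by exists 0%N => //; case: (sF 0%N).
  move=> x y [k _ Fx] [l _ Fy]; exists (maxn k l) => //; apply: is_idealD => //.
    by apply: Fle Fx; rewrite leq_maxl.
  by apply: Fle Fy; rewrite leq_maxr.
by move=> c x [k _ Fx]; exists k => //; apply: is_idealM.
Qed.

Lemma span_set_sub S (s : seq R) : is_ideal S ->
  (forall x, x \in s -> S x) -> span_set s `<=` S.
Proof.
move=> sS sP _ [c ->]; rewrite -(ideal_ofE sS); apply: ideal_sum => i _.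
by rewrite ideal_ofE; apply: is_idealM => //; apply: sP; rewrite mem_nth.
Qed.

Lemma mem_span_set (s : seq R) x : x \in s -> span_set s x.
Proof.
move=> xs; have i_s : (index x s < size s)%N by rewrite index_mem.
exists (fun i => (i == Ordinal i_s)%:R).
rewrite (bigD1 (Ordinal i_s)) //= eqxx mul1r nth_index // big1 ?addr0 // => i.
by move=> /negPf ->; rewrite mul0r.
Qed.

Lemma span_set0P x : span_set [::] x <-> x = 0.
Proof.
by split=> [[c ->]|->]; [rewrite big_ord0|exists (fun=> 0); rewrite big_ord0].
Qed.

Lemma span_set1P y x : span_set [:: y] x <-> exists c, x = c * y.
Proof.
split=> [[c ->]|[c ->]]; first by exists (c ord0); rewrite big_ord1.
by exists (fun=> c); rewrite big_ord1.
Qed.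

(** The union of the chain is an ideal; its finitely many generators already lie in a single
    term. *)
Lemma noetherian_acc (F : nat -> set R) : noetherian R ->
  (forall k, is_ideal (F k)) -> (forall k, F k `<=` F k.+1) ->
  exists l, forall k, (l <= k)%N -> F k = F l.
Proof.
move=> noeth sF FS.
have Fle k l : (k <= l)%N -> F k `<=` F l.
  by move=> /subnK <-; elim: (l - k)%N => [//|j IHj] x /IHj /FS.
have sU := bigcup_ideal sF Fle.
have [s sE] := noeth (ideal_of sU); rewrite ideal_ofE in sE.
have [K KP] : exists l, forall x, x \in s -> F l x.
  have sU' x : x \in s -> exists k, F k x.
    by move=> /mem_span_set; rewrite -sE => -[k _ Fx]; exists k.
  move: {sE} s sU'; elim=> [|x s IHs] sP; first by exists 0%N.
  have [|K KP] := IHs; first by move=> y ys; apply: sP; rewrite inE ys orbT.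
  have [k Fx] := sP x (mem_head _ _); exists (maxn K k) => y.
  rewrite inE => /predU1P[->|/KP Fy]; first by apply: Fle Fx; rewrite leq_maxr.
  by apply: Fle Fy; rewrite leq_maxl.
exists K => k Kk; apply/seteqP; split; last exact: Fle.
move=> x Fx; have : (\bigcup_k F k) x by exists k.
by rewrite sE; apply: span_set_sub.
Qed.

(** Otherwise every proper ideal above [I] has a strictly larger one, and iterating a choice of such
    ideals from [I] contradicts the ascending chain condition. *)
Lemma exists_maximal_ideal I : noetherian R -> ~ I 1 ->
  exists2 M, maximal_ideal M & I `<=` M.
Proof.
move=> noeth I1; apply: contrapT => nomax.
pose Q K := I `<=` K /\ ~ K 1.
have step K : exists L, Q K -> Q L /\ (K : set R) `<` L.
  have [[IK K1]|nQ] := pselect (Q K); last by exists K.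
  apply: contrapT => noL; apply: nomax; exists K => //; split=> // L KL L1.
  apply/seteqP; split=> //; apply: contrapT => LK; apply: noL; exists L => _.
  by split; [split=> //; apply: subset_trans KL|split].
have [f fP] := choice step.
pose F k := iter k f I.
have QF k : Q (F k) by elim: k => [|k /fP[]//]; split.
have [k|k|K KP] := @noetherian_acc (fun k => F k : set R) noeth.
- exact: ideal_submodule.
- by have [_ []] := fP _ (QF k).
- have [_ [_]] := fP _ (QF K); apply.
  by have /= := KP K.+1 (leqnSn K); rewrite /F /= => ->.
Qed.

(** A non-unit [1 - x] would generate a proper ideal, hence lie in [m] together with [x], and so
    would [1]. *)
Lemma local_ring_unit m x : noetherian R -> local_ring m -> m x ->
  exists y, (1 - x) * y = 1.
Proof.
move=> noeth [[m1 _] mP] mx.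
have sT := scale_set_ideal (1 - x) is_idealT; pose T := ideal_of sT.
have [|nT1] := pselect (T 1); first by rewrite /T ideal_ofE => -[y _]; exists y.
have [M maxM TM] := exists_maximal_ideal noeth nT1.
have M1x : M (1 - x) by apply: TM; rewrite /T ideal_ofE; exists 1; rewrite ?mulr1.
by case: m1; rewrite -(mP M maxM) -[1](subrK x); apply: ideal_D => //; rewrite (mP M maxM).
Qed.

(* c, d is a regular sequence in either order. *)
Definition regular_pair c d : Prop :=
  [/\ GRing.lreg c, GRing.lreg d &
      forall u v, c * u = d * v -> exists t, u = d * t].

Lemma regular_pair_sym c d : regular_pair c d -> regular_pair d c.
Proof.
move=> [rc rd cd]; split=> // u v E; have [t tE] := cd _ _ (esym E).
by exists t; apply: rd; rewrite E tE mulrCA.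
Qed.

Lemma regular_pairMl c c' d :
  regular_pair c d -> regular_pair c' d -> regular_pair (c * c') d.
Proof.
move=> [rc rd cd] [rc' _ cd']; split=> //; first exact: lregM.
by move=> u v; rewrite -mulrA => /cd[t /cd'].
Qed.

Lemma regular_pairXl c d n : regular_pair c d -> regular_pair (c ^+ n) d.
Proof.
move=> cd; elim: n => [|n IHn]; last by rewrite exprS; apply: regular_pairMl.
have [_ rd _] := cd; split=> //; first exact: lreg1.
by move=> u v; rewrite mul1r; exists v.
Qed.

Lemma regular_pairX c d k l : regular_pair c d -> regular_pair (c ^+ k) (d ^+ l).
Proof.
by move=> cd; apply/regular_pairXl/regular_pair_sym/regular_pairXl/regular_pair_sym.
Qed.

(* The first Koszul homology of a, b is killed by the ideal (a, b), hence by the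
   regular sequence x, y. *)
Lemma koszul_exact a b x y u v :
  GRing.lreg x -> (forall u v, y * u = x * v -> exists t, u = x * t) ->
  (exists c d, x = c * a + d * b) -> (exists c d, y = c * a + d * b) ->
  a * u + b * v = 0 -> exists t, u = t * b /\ v = - (t * a).
Proof.
move=> rx xy [c [d xE]] [c' [d' yE]] uv.
have via (k h z w : R) : h = 0 -> z - w = k * h -> z = w.
  by move=> -> /eqP; rewrite mulr0 subr_eq0 => /eqP.
(* Writing [x] and [y] in terms of [a], [b] makes [x (u, v) = p (b, -a)] and
   [y (u, v) = q (b, -a)]. *)
pose p := d * u - c * v; pose q := d' * u - c' * v.
have xu : x * u = p * b by apply: (via c _ _ _ uv); rewrite xE /p; ring.
have xv : x * v = - (p * a) by apply: (via d _ _ _ uv); rewrite xE /p; ring.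
have yu : y * u = q * b by apply: (via c' _ _ _ uv); rewrite yE /q; ring.
have yv : y * v = - (q * a) by apply: (via d' _ _ _ uv); rewrite yE /q; ring.
(* Checked after multiplication by the regular element [x = c a + d b]: both [a] and [b] kill
   [y p - x q]. *)
have ypq : y * p = x * q.
  have zb : y * (p * b) - x * (q * b) = 0 by rewrite -xu -yu; ring.
  have za : x * (q * a) - y * (p * a) = 0.
    by rewrite -[p * a]opprK -[q * a]opprK -xv -yv; ring.
  apply: rx; apply/eqP; rewrite -subr_eq0; apply/eqP.
  have -> : x * (y * p) - x * (x * q) =
      d * (y * (p * b) - x * (q * b)) - c * (x * (q * a) - y * (p * a)).
    by rewrite [X in X * (y * p) - X * _]xE; ring.
  by rewrite za zb !mulr0 subr0.
have [t pE] := xy _ _ ypq.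
exists t; split; apply: rx; first by rewrite xu pE mulrA.
by rewrite xv pE mulrN mulrA.
Qed.

Lemma lreg_of_mul_eq0 c : (forall u, c * u = 0 -> u = 0) -> GRing.lreg c.
Proof.
move=> cP u v E; apply/eqP; rewrite -subr_eq0; apply/eqP/cP.
by rewrite mulrBr E subrr.
Qed.

(** A Nakayama argument. If [a u = 0], exactness at [(u, 0)] gives [u = t b] with again [a t = 0].
    Iterating yields ascending principal ideals [(p k)]; where they stabilise, [p (K + 1)] equals
    [p (K + 1) b c], and [1 - b c] is a unit. *)
Lemma lreg_of_koszul_exact m a b : noetherian R -> local_ring m -> m b ->
  (forall u v, a * u + b * v = 0 -> exists t, u = t * b /\ v = - (t * a)) ->
  GRing.lreg a.
Proof.
move=> noeth loc mb ex; apply: lreg_of_mul_eq0 => u0 au0.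
have [g gP] : {g | forall u, a * u = 0 -> u = g u * b /\ a * g u = 0}.
  apply: cid; suff /choice[g gP] : forall u, exists t, a * u = 0 -> u = t * b /\ a * t = 0.
    by exists g.
  move=> u; have [au|nau] := pselect (a * u = 0); last by exists 0.
  have [|t [tb ta]] := ex u 0; first by rewrite au mulr0 addr0.
  by exists t => _; split=> //; apply/eqP; rewrite mulrC -oppr_eq0 -ta.
pose p k := iter k g u0.
have ap k : a * p k = 0 by elim: k => [//|k /gP[]].
have pS k : p k = p k.+1 * b by case: (gP _ (ap k)).
have [k|k _ [c _ <-]|K KP] :=
    @noetherian_acc (fun k => scale_set (p k) setT) noeth.
- exact: scale_set_ideal.
- by exists (b * c); rewrite // mulrA -pS.
have : scale_set (p K) setT (p K.+1) by rewrite -(KP K.+1) //; exists 1; rewrite ?mulr1.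
move=> [c _ pc].
have [y yP] : exists y, (1 - b * c) * y = 1.
  by apply: local_ring_unit loc _ => //; rewrite mulrC; apply: ideal_M.
have pK0 : p K.+1 = 0.
  rewrite -[LHS]mulr1 -yP mulrA mulrBr mulr1 [X in X - _](_ : _ = p K.+1 * (b * c)).
    by rewrite subrr mul0r.
  by rewrite mulrA -pS pc.
suff H k : (k <= K.+1)%N -> p (K.+1 - k)%N = 0 by rewrite -(H K.+1) // subnn.
elim: k => [|k IHk] kK; first by rewrite subn0.
by rewrite pS -subSn // subSS IHk ?mul0r // ltnW.
Qed.

(** Depth at least two supplies a regular sequence [x, y] in [m]. Suitable powers of both lie in
    [(a, b)] and stay regular, so [koszul_exact] applies; regularity of [a] and [b] and the
    divisibility are read off from it. *)
Lemma regular_pair_of_depth m a b : noetherian R -> local_ring m ->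
  (exists n, (2 <= n)%N /\ depth m n) -> m a -> m b ->
  (forall x, m x -> exists k, exists c d, x ^+ k = c * a + d * b) ->
  regular_pair a b.
Proof.
move=> noeth loc [n [n2 [[s [sn sm [_ reg]]] _]]] ma mb pow.
case: s sn sm reg n2 => [|x [|y s]] <- // sm reg _.
have rx : GRing.lreg x.
  by apply: lreg_of_mul_eq0 => u /span_set0P /(reg 0%N) /span_set0P; apply.
have xy u v : y * u = x * v -> exists t, u = x * t.
  move=> E; suff /span_set1P[t ->] : span_set [:: x] u by exists t; rewrite mulrC.
  by apply: (reg 1%N isT); apply/span_set1P; exists v; rewrite [y * u]E mulrC.
have [k xk] := pow x (sm _ (mem_head _ _)).
have [|l yl] := pow y; first by apply: sm; rewrite !inE eqxx orbT.
have rxk : GRing.lreg (x ^+ k) by apply: lregX.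
have xyk u v : y * u = x ^+ k * v -> exists t, u = x ^+ k * t.
  elim: {xk rxk} k u v => [|k IHk] u v; first by rewrite expr0; exists u; rewrite mul1r.
  rewrite exprS -mulrA => E; have [t tE] := xy _ _ E.
  have [|w wE] := IHk t v; last by exists w; rewrite tE wE mulrA.
  by apply: rx; rewrite -E tE mulrCA.
have xykl u v : y ^+ l * u = x ^+ k * v -> exists t, u = x ^+ k * t.
  elim: {yl} l u v => [|l IHl] u v; first by rewrite mul1r; exists v.
  by rewrite exprSr -mulrA => /IHl[t /xyk].
have ex u v : a * u + b * v = 0 -> exists t, u = t * b /\ v = - (t * a).
  exact: koszul_exact rxk xykl xk yl.
have ra := lreg_of_koszul_exact noeth loc mb ex.
have rb : GRing.lreg b.
  apply: (lreg_of_koszul_exact noeth loc ma) => u v; rewrite addrC => /ex[t [-> ->]].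
  by exists (- t); rewrite !mulNr opprK.
split=> // u v E; have [|t [-> _]] := ex u (- v); last by exists t; rewrite mulrC.
by rewrite E mulrN subrr.
Qed.

End IdealLengths.

(** * Colengths of ideals generated by a regular pair *)

Section RegularPairLengths.
Variable R : comNzRingType.
Implicit Types (A B N M : set R) (a b c d : R).

Local Notation is_ideal := (@is_submodule R R^o).
Local Notation len N M := (@length R R^o N M).

Lemma length_mul c N M (N' M' : set R) :
  is_ideal N -> is_ideal M -> N `<=` M -> is_ideal N' -> is_ideal M' -> N' `<=` M' ->
  (forall u, M u -> M' (c * u)) ->
  (forall w, M' w -> exists2 u, M u & N' (w - c * u)) ->
  (forall u, M u -> N' (c * u) <-> N u) ->
  len N M = len N' M'.
Proof.
move=> sN sM NM sN' sM' NM' fM fsurj fN.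
apply: (@length_morph R R^o R^o ( *%R c)) => // [u v _ _|e u _].
  exact: (@mulrDr R).
exact: (@mulrCA R).
Qed.

Lemma sum_setl A B : is_ideal B -> A `<=` sum_set A B.
Proof. exact: (@submodule_addl R R^o). Qed.

Lemma sum_setr A B : is_ideal A -> B `<=` sum_set A B.
Proof. exact: (@submodule_addr R R^o). Qed.

Lemma sum_set_sub A B N : is_ideal N -> A `<=` N -> B `<=` N -> sum_set A B `<=` N.
Proof. exact: (@submodule_add_sub R R^o). Qed.

Lemma sum_setC A B : sum_set A B = sum_set B A.
Proof.
by apply/seteqP; split=> _ [u [v [Au Bv ->]]]; exists v, u; rewrite addrC.
Qed.

Lemma colengthT : colength [set: R] = 0%:E.
Proof. by apply: lengthxx. Qed.

Lemma colength_fin A B x : is_ideal A -> is_ideal B -> A `<=` B ->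
  colength A = x%:E -> exists p q, [/\ len A B = p%:E, colength B = q%:E & x = p + q].
Proof. by move=> sA sB AB; apply: length_split. Qed.

(* Filter (cA + dB <= cA + dR <= cR + dR); multiplication by c and d identifies
   the two layers with R / (A + dR) and R / (B + c(A : d)). *)
Lemma colength_regular_pair c d A B xA xB xQ : regular_pair c d ->
  is_ideal A -> is_ideal B ->
  colength A = xA%:E -> colength B = xB%:E ->
  colength (sum_set (scale_set c setT) (scale_set d setT)) = xQ%:E ->
  exists y z, [/\ colength (sum_set (scale_set c A) (scale_set d B)) = y%:E,
    colength (colon_set A d `&` colon_set B c) = z%:E & y + z = xQ + xA + xB].
Proof.
move=> [rc rd cd] sA sB lA lB lQ.
have sT := is_idealT R.
have sAd := colon_set_ideal d sA; have sBc := colon_set_ideal c sB.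
have sdT := scale_set_ideal d sT; have scT := scale_set_ideal c sT.
have scA := scale_set_ideal c sA; have sdB := scale_set_ideal d sB.
have scE := scale_set_ideal c sAd; have sEI := setI_ideal sAd sBc.
have sAT := sum_set_ideal sA sdT; have sBE := sum_set_ideal sB scE.
have scAT := sum_set_ideal scA sdT; have scAB := sum_set_ideal scA sdB.
have sQ := sum_set_ideal scT sdT.
have AE : A `<=` colon_set A d by move=> u Au; apply: is_idealM.
have [p [q [_ lE pq]]] := colength_fin sA sAd AE lA.
have [q' [p' [lA1 lA2 pq']]] := colength_fin sA sAT (sum_setl sdT) lA.
(* Multiplication by [d] identifies [R / (A : d)] with [(A + dR) / A]. *)
have lq : q = q'.
  suff : colength (colon_set A d) = len A (sum_set A (scale_set d setT)).
    by rewrite lE lA1 => -[].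
  apply: (@length_mul d) => //.
  - exact: sum_setl.
  - by move=> u _; apply: (sum_setr sA); exists u.
  - move=> _ [u [_ [Au [v _ <-] ->]]]; exists v => //.
    by rewrite addrK.
have [w [w' [lB1 lB2 lBw]]] := colength_fin sB sBE (sum_setl scE) lB.
(* Multiplication by [c] sends [(A : d)] onto [(B + c (A : d)) / B] with kernel the intersection of
   the two colon ideals. *)
have lw : len (colon_set A d `&` colon_set B c) (colon_set A d) = w%:E.
  rewrite -lB1; apply: (@length_mul c) => //.
  - exact: sum_setl.
  - by move=> u Eu; apply: (sum_setr sB); exists u.
  - by move=> _ [u [_ [Bu [v Ev <-] ->]]]; exists v; rewrite // addrK.
  - by move=> u Eu; split=> [? //|[]].
have lEI : colength (colon_set A d `&` colon_set B c) = (w + q)%:E.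
  by apply: (length_add sEI sAd sT) => // u [].
have cATsub : sum_set (scale_set c A) (scale_set d setT) `<=`
    sum_set (scale_set c setT) (scale_set d setT).
  by move=> _ [_ [v [[x _ <-] dv ->]]]; exists (c * x), v; split=> //; exists x.
have cABsub : sum_set (scale_set c A) (scale_set d B) `<=`
    sum_set (scale_set c A) (scale_set d setT).
  by move=> _ [v [_ [dv [x _ <-] ->]]]; exists v, (d * x); split=> //; exists x.
have l1 : len (sum_set (scale_set c A) (scale_set d setT))
    (sum_set (scale_set c setT) (scale_set d setT)) = p'%:E.
  rewrite -lA2; apply/esym/(@length_mul c) => //.
  - by move=> u _; apply: (sum_setl sdT); exists u.
  - move=> _ [_ [_ [[u _ <-] [v _ <-] ->]]]; exists u => //.
    by apply: (sum_setr scA); exists v => //; rewrite addrAC subrr add0r.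
  - move=> u _; split.
      move=> [_ [_ [[x Ax <-] [v _ <-] E]]].
      have [|t tE] := cd (u - x) v; first by rewrite mulrBr E addrAC subrr add0r.
      by exists x, (d * t); split=> //; [exists t|rewrite -tE addrC subrK].
    move=> [x [_ [Ax [v _ <-] ->]]]; exists (c * x), (d * (c * v)).
    by split; [exists x|exists (c * v)|rewrite mulrDr [c * (d * v)]mulrCA].
have l2 : len (sum_set (scale_set c A) (scale_set d B))
    (sum_set (scale_set c A) (scale_set d setT)) = w'%:E.
  rewrite -lB2; apply/esym/(@length_mul d) => //.
  - by move=> u _; apply: (sum_setr scA); exists u.
  - move=> _ [_ [_ [[u Au <-] [v _ <-] ->]]]; exists v => //.
    by apply: (sum_setl sdB); exists u => //; rewrite addrK.
  - move=> u _; split.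
      move=> [_ [_ [[x Ax <-] [v Bv <-] E]]].
      (* Here regularity enters: [c x] is divisible by [d], so [x = d t], and [t] lies in [(A : d)]
         because [x] lies in [A]. *)
      have cxd : c * x = d * (u - v) by rewrite mulrBr E addrK.
      have [t tE] := cd x _ cxd.
      exists v, (c * t); split=> //; first by exists t; rewrite // /colon_set /= -tE.
      by apply: rd; rewrite E mulrDr tE addrC mulrCA.
    move=> [v [_ [Bv [t Et <-] ->]]]; exists (c * (d * t)), (d * v).
    by split; [exists (d * t)|exists v|rewrite mulrDr addrC mulrCA].
exists (w' + (p' + xQ)), (w + q); split=> //; last by rewrite pq' lBw lq; ring.
apply: (length_add scAB scAT sT) => //.
exact: (length_add scAT sQ sT).
Qed.

(** One exponent at a time: [(a^(n+1), b) = a (a^n, b) + b R], so [colength_regular_pair] with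
    [A = (a^n, b)] and [B = R] adds the colength of [(a, b)] at each step. *)
Lemma colength_regular_pairX a b x k l : regular_pair a b ->
  colength (sum_set (scale_set a setT) (scale_set b setT)) = x%:E ->
  colength (sum_set (scale_set (a ^+ k) setT) (scale_set (b ^+ l) setT)) =
    (k%:Z * l%:Z * x)%:E.
Proof.
suff step a' b' y n : regular_pair a' b' ->
    colength (sum_set (scale_set a' setT) (scale_set b' setT)) = y%:E ->
    colength (sum_set (scale_set (a' ^+ n) setT) (scale_set b' setT)) = (n%:Z * y)%:E.
  move=> ab lab; rewrite -mulrA; apply: (step).
    exact/regular_pair_sym/regular_pairXl/regular_pair_sym.
  by rewrite sum_setC; apply: step; [exact: regular_pair_sym|rewrite sum_setC].
move=> ab lab; have sT := is_idealT R; elim: n => [|n IHn].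
  rewrite mul0r -colengthT; congr colength; apply/seteqP; split=> // u _.
  by apply: sum_setl; [exact: scale_set_ideal|exists u; rewrite ?mul1r].
have sab := sum_set_ideal (scale_set_ideal (a' ^+ n) sT) (scale_set_ideal b' sT).
have [z [w [lz lw zw]]] := colength_regular_pair ab sab sT IHn colengthT lab.
(* As [b'] lies in [(a'^n, b')], both colon ideals are the whole ring. *)
have w0 : w = 0.
  suff E : colon_set (sum_set (scale_set (a' ^+ n) [set: R]) (scale_set b' [set: R])) b'
      `&` colon_set [set: R] a' = setT by move: lw; rewrite E colengthT => -[].
  apply/seteqP; split=> // u _; split=> //.
  by apply: sum_setr; [exact: scale_set_ideal|exists u].
have <- : z = n.+1%:Z * y by move: zw; rewrite w0 !addr0 => ->; rewrite intS; ring.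
rewrite -lz; congr colength; apply/seteqP; split.
  move=> _ [_ [_ [[u _ <-] [v _ <-] ->]]].
  exists (a' * (a' ^+ n * u)), (b' * v); split; last by rewrite exprS mulrA.
    by exists (a' ^+ n * u) => //; apply: sum_setl; [exact: scale_set_ideal|exists u].
  by exists v.
move=> _ [_ [_ [[_ [_ [_ [[u _ <-] [v _ <-] ->]]] <-] [t _ <-] ->]]].
exists (a' ^+ n.+1 * u), (b' * (a' * v + t)).
by split; [exists u|exists (a' * v + t)|rewrite exprS; ring].
Qed.

End RegularPairLengths.

(** * Powers of ideals and monomials of the extended Rees algebra *)

Section PowerProducts.
Variable R : comNzRingType.
Implicit Types (I J : ideal R) (a b u : R).

Lemma powprod_mul I J r s r' s' u v : powprod I J r s u -> powprod I J r' s' v ->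
  powprod I J (r + r') (s + s') (u * v).
Proof. exact: (@powprodz_in R I J (r%:Z, s%:Z) (r'%:Z, s'%:Z)). Qed.

Lemma powprod_expl I J a n : I a -> powprod I J n 0 (a ^+ n).
Proof.
move=> Ia; elim: n => [|n IHn]; first exact: (@powprodz_top R I J (0, 0)).
by rewrite exprS; apply: (@powprod_mul I J 1 0 n 0) => //; apply: powprodz10.
Qed.

Lemma powprod_expr I J b n : J b -> powprod I J 0 n (b ^+ n).
Proof.
move=> Jb; elim: n => [|n IHn]; first exact: (@powprodz_top R I J (0, 0)).
by rewrite exprS; apply: (@powprod_mul I J 0 1 0 n) => //; apply: powprodz01.
Qed.

Lemma powprod_le I J r s r' s' u : (r' <= r)%N -> (s' <= s)%N ->
  powprod I J r s u -> powprod I J r' s' u.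
Proof.
move=> rr' ss'; apply: ideal_mul_ind => x y Ix Jy; apply: ideal_mul_in.
  exact: ideal_exp_le Ix.
exact: ideal_exp_le Jy.
Qed.

(** Turns the Hilbert polynomial of [IJ] into the diagonal of the bigraded one. *)
Lemma ideal_exp_mul I J n : ideal_exp (ideal_mul I J) n = powprod I J n n :> set R.
Proof.
apply/seteqP; split.
  elim: n => [|n IHn]; first by move=> u _; apply: (@powprodz_top R I J (0, 0)).
  apply: ideal_mul_ind => x y IJx /IHn; apply: (@powprod_mul I J 1 1 n n).
  move: x IJx; suff : ideal_mul I J `<=` powprod I J 1 1 by [].
  apply: ideal_mul_ind => {}x {}y Ix Jy.
  by apply: ideal_mul_in; apply: ideal_exp1.
apply: ideal_mul_ind => x y; elim: n x y => [//|n IHn] x y.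
move=> [s [sP ->]] [t [tP ->]]; rewrite mulr_suml big_seq.
apply: ideal_sum => p /sP[p1 p2]; rewrite mulr_sumr big_seq.
apply: ideal_sum => q /tP[q1 q2]; rewrite mulrACA.
by apply: ideal_mul_in; [apply: ideal_mul_in|apply: IHn].
Qed.

End PowerProducts.

Section ReesMonomials.
Variables (R : comNzRingType) (I J : ideal R).
Implicit Types (f g : ext_rees I J) (p q : int * int).

Lemma rees_val_inj f g : (forall q, (rees_val f)@_q = (rees_val g)@_q) -> f = g.
Proof. by move=> fg; apply: val_inj; apply/malgP. Qed.

Lemma rees_coefD f g q :
  (rees_val (f + g))@_q = (rees_val f)@_q + (rees_val g)@_q.
Proof. exact: mcoeffD. Qed.

Lemma rees_coefB f g q :
  (rees_val (f - g))@_q = (rees_val f)@_q - (rees_val g)@_q.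
Proof. exact: mcoeffB. Qed.

Lemma rees_coef_sub_eq0 f g h q u v w : f - g - h = 0 ->
  (rees_val f)@_q = u -> (rees_val g)@_q = v -> (rees_val h)@_q = w -> w = u - v.
Proof.
by move=> /eqP; rewrite subr_eq0 => /eqP <- <- <- <-; rewrite rees_coefB.
Qed.

Lemma rees_coef_mem f p : powprodz I J p (rees_val f)@_p.
Proof. by have /asboolP := rees_valP f; apply. Qed.

Lemma rees_coefZ c f q : (rees_val (c *: f))@_q = c * (rees_val f)@_q.
Proof. exact: mcoeffZ. Qed.

Lemma rees_coef0 q : (rees_val (0 : ext_rees I J))@_q = 0.
Proof. exact: mcoeff0. Qed.

Lemma rees_coef_monomialM p u (pu : powprodz I J p u) f q :
  (rees_val (rees_monomial pu * f))@_q = u * (rees_val f)@_(q - p).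
Proof.
have -> : rees_val (rees_monomial pu * f) = laurent_mul << u *g p >> (rees_val f) by [].
rewrite laurent_mulUl raddf_sum [in RHS](monalgE (rees_val f)) raddf_sum mulr_sumr /=.
by apply: eq_bigr => q' _; rewrite !mcoeffU mulrnAr eq_sym [in RHS]eq_sym subr_eq addrC.
Qed.

Variables (a b : R) (Ia : I a) (Jb : J b).
Local Notation x := (rees_at1 J Ia).
Local Notation y := (rees_bt2 I Jb).

Lemma rees_coef_XM n f (i j : int) :
  (rees_val (x ^+ n * f))@_(i + n%:Z, j) = a ^+ n * (rees_val f)@_(i, j).
Proof.
elim: n => [|n IHn]; first by rewrite !mul1r addr0.
rewrite [x ^+ _]exprS -[x * _ * f]mulrA rees_coef_monomialM.
have -> : (i + n.+1%:Z, j) - (1, 0) = ((i + n%:Z, j) : int * int).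
  by congr (_, _); rewrite /= ?subr0 // intS; ring.
by rewrite IHn mulrA -exprS.
Qed.

Lemma rees_coef_YM n f (i j : int) :
  (rees_val (y ^+ n * f))@_(i, j + n%:Z) = b ^+ n * (rees_val f)@_(i, j).
Proof.
elim: n => [|n IHn]; first by rewrite !mul1r addr0.
rewrite [y ^+ _]exprS -[y * _ * f]mulrA rees_coef_monomialM.
have -> : (i, j + n.+1%:Z) - (0, 1) = ((i, j + n%:Z) : int * int).
  by congr (_, _); rewrite /= ?subr0 // intS; ring.
by rewrite IHn mulrA -exprS.
Qed.

Lemma rees_coef_XYM k l f (i j i' j' : int) : i = i' + k%:Z -> j = j' + l%:Z ->
  (rees_val (x ^+ k * (y ^+ l * f)))@_(i, j) = a ^+ k * (b ^+ l * (rees_val f)@_(i', j')).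
Proof. by move=> -> ->; rewrite rees_coef_XM rees_coef_YM. Qed.

(* u t1^r t2^s, with junk value 0 when u is not in I^r J^s. *)
Definition rees_mono r s (u : R) : ext_rees I J :=
  if pselect (powprod I J r s u) is left h
  then @rees_monomial R I J (r%:Z, s%:Z) u h else 0.

Lemma rees_mono_coef r s u q : powprod I J r s u ->
  (rees_val (rees_mono r s u))@_q = u *+ ((r%:Z, s%:Z) == q).
Proof. by move=> Iu; rewrite /rees_mono; case: pselect => //= h; rewrite mcoeffU. Qed.

Lemma rees_mono_coefE r s u : powprod I J r s u ->
  (rees_val (rees_mono r s u))@_(r%:Z, s%:Z) = u.
Proof. by move=> Iu; rewrite rees_mono_coef // eqxx. Qed.

Lemma rees_monoD r s u v : powprod I J r s u -> powprod I J r s v ->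
  rees_mono r s (u + v) = rees_mono r s u + rees_mono r s v.
Proof.
move=> Iu Iv; apply: rees_val_inj => q; rewrite rees_coefD !rees_mono_coef ?mulrnDl //.
exact: ideal_D.
Qed.

Lemma rees_monoZ r s c u : powprod I J r s u -> rees_mono r s (c * u) = c *: rees_mono r s u.
Proof.
move=> Iu; apply: rees_val_inj => q; rewrite rees_coefZ !rees_mono_coef ?mulrnAr //.
exact: ideal_M.
Qed.

Lemma rees_monoXM n r s u : powprod I J r s u ->
  x ^+ n * rees_mono r s u = rees_mono (r + n) s (a ^+ n * u).
Proof.
move=> Iu; apply: rees_val_inj => -[q1 q2].
have Iau : powprod I J (r + n) s (a ^+ n * u).
  by rewrite addnC; apply: (@powprod_mul _ _ _ n 0) => //; apply: powprod_expl.
rewrite -[q1](subrK n%:Z) rees_coef_XM !rees_mono_coef // mulrnAr; congr (_ *+ nat_of_bool _).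
by rewrite !xpair_eqE PoszD (inj_eq (addIr _)).
Qed.

Lemma rees_monoYM n r s u : powprod I J r s u ->
  y ^+ n * rees_mono r s u = rees_mono r (s + n) (b ^+ n * u).
Proof.
move=> Iu; apply: rees_val_inj => -[q1 q2].
have Ibu : powprod I J r (s + n) (b ^+ n * u).
  by rewrite addnC; apply: (@powprod_mul _ _ _ 0 n) => //; apply: powprod_expr.
rewrite -[q2](subrK n%:Z) rees_coef_YM !rees_mono_coef // mulrnAr; congr (_ *+ nat_of_bool _).
by rewrite !xpair_eqE PoszD (inj_eq (addIr _)).
Qed.

(** Coefficients of elements of the extended Rees algebra lie in the right ideals, so the junk value
    of [rees_mono] is not met. *)
Lemma homogeneous_rees_mono r s f : rees_homogeneous (r%:Z, s%:Z) f ->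
  f = rees_mono r s (rees_val f)@_(r%:Z, s%:Z).
Proof.
move=> hf; apply: rees_val_inj => q; rewrite rees_mono_coef; last first.
  exact: (rees_coef_mem f (r%:Z, s%:Z)).
by have [<-|/eqP qrs] := eqVneq; rewrite ?mulr1n // hf //; apply/eqP => E; apply: qrs.
Qed.

Lemma rees_mono_homogeneous r s u : rees_homogeneous (r%:Z, s%:Z) (rees_mono r s u).
Proof.
move=> q qrs; rewrite /rees_mono; case: pselect => [h|_]; last exact: rees_coef0.
by rewrite /= mcoeffU eq_sym (negPf qrs).
Qed.

End ReesMonomials.

(** * Local cohomology as a direct limit *)

Section LocalCohomology.
Variables (R : comNzRingType) (I J : ideal R) (a b : R) (Ia : I a) (Jb : J b).
Variables r s : nat.
Local Notation x := (rees_at1 J Ia).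
Local Notation y := (rees_bt2 I Jb).
Local Notation is_ideal := (@is_submodule R R^o).
Local Notation len N M := (@length R R^o N M).
Local Notation P k := (powprod I J (r + k) (s + k)).

(* H^2_(r, s) is the direct limit of the modules P k / koszul_den k under
   multiplication by a b. *)
Definition koszul_den k : set R :=
  sum_set (scale_set (a ^+ k) (powprod I J r (s + k)))
          (scale_set (b ^+ k) (powprod I J (r + k) s)).

(** The structure map of the limit: the fraction [u t1^(r+k) t2^(s+k) / (a t1 b t2)^k] has degree
    [(r, s)]. *)
Definition h2map k (u : R^o) : rees_H2 Ia Jb :=
  quot_class (cech_d1_image_submodule x y)
    (Defs.frac (x * y) (rees_mono I J (r + k) (s + k) u) k).

Lemma koszul_den_ideal k : is_ideal (koszul_den k).
Proof. by apply: sum_set_ideal; apply: scale_set_ideal; apply: ideal_submodule. Qed.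

Lemma koszul_den_sub k : koszul_den k `<=` P k.
Proof.
apply: sum_set_sub; first exact: ideal_submodule.
  move=> _ [u Iu <-]; rewrite addnC; apply: (@powprod_mul _ _ _ k 0) => //.
  exact: powprod_expl.
move=> _ [u Iu <-]; rewrite [(s + k)%N]addnC.
by apply: (@powprod_mul _ _ _ 0 k) => //; apply: powprod_expr.
Qed.

Lemma frac_addl (A : comAlgType R) (z u v : A) k :
  Defs.frac z u k + Defs.frac z v k = Defs.frac z (u + v) k.
Proof. by rewrite fracD; apply/frac_eqP; exists 0%N; rewrite exprD; ring. Qed.

Lemma frac_mulX (A : comAlgType R) (z u : A) k j :
  Defs.frac z u k = Defs.frac z (z ^+ j * u) (k + j).
Proof. by apply/frac_eqP; exists 0%N; rewrite exprD; ring. Qed.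

Lemma h2mapD k u v : P k u -> P k v -> h2map k (u + v) = h2map k u + h2map k v.
Proof. by move=> Pu Pv; rewrite /h2map -quot_classD frac_addl rees_monoD. Qed.

Lemma h2mapZ k c (u : R^o) : P k u -> h2map k (c *: u) = c *: h2map k u.
Proof. by move=> Pu; rewrite /h2map -quot_classZ fracZ -rees_monoZ. Qed.

Lemma powprod_step k j u : P k u -> P (k + j) ((a * b) ^+ j * u).
Proof.
move=> Pu; have -> : (a * b) ^+ j * u = u * (a ^+ j * b ^+ j) by rewrite exprMn mulrC.
rewrite !addnA; apply: powprod_mul => //.
by have := powprod_mul (powprod_expl J j Ia) (powprod_expr I j Jb); rewrite !addn0 add0n.
Qed.

Lemma rees_mono_step k j u : P k u ->
  (x * y) ^+ j * rees_mono I J (r + k) (s + k) u =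
    rees_mono I J (r + (k + j)) (s + (k + j)) ((a * b) ^+ j * u).
Proof.
move=> Pu; have Pu' : powprod I J (r + k) (s + k + j) (b ^+ j * u).
  rewrite [(s + k + j)%N]addnC; apply: (@powprod_mul _ _ _ 0 j) => //.
  exact: powprod_expr.
rewrite exprMn -mulrA (rees_monoYM Jb j Pu) (rees_monoXM Ia j Pu').
by rewrite mulrA -exprMn !addnA.
Qed.

Lemma h2map_step k j u : P k u -> h2map k u = h2map (k + j) ((a * b) ^+ j * u).
Proof. by move=> Pu; rewrite /h2map -rees_mono_step // -frac_mulX. Qed.

(** The fraction is a Cech boundary [f2 / y^n2 - f1 / x^n1]. Clearing denominators and taking the
    coefficient in degree [(r+k+e, s+k+e)] leaves only the components of [f2] in degree [(r, s+n2)]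
    and of [f1] in degree [(r+n1, s)]. *)
Lemma h2map_eq0 k u : P k u ->
  h2map k u = 0 -> exists j, koszul_den (k + j) ((a * b) ^+ j * u).
Proof.
move=> Pu /quot_class_eqP; rewrite subr0 => -[[w1 w2] _].
elim/loc_ind: w1 => f1 n1; elim/loc_ind: w2 => f2 n2.
rewrite /cech_d1 /= cech_from_xE cech_from_yE fracN fracD => /frac_eqP[j].
move: (rees_mono_coefE Pu); set mu := rees_mono _ _ _ _ _ => muE jE.
(* [e] absorbs both denominators and the exponent [j] that comes with equality of fractions. *)
pose e := (j + n1 + n2)%N.
have {}jE : x ^+ (k + e) * (y ^+ (k + (j + n1)) * f2) -
    x ^+ (k + (j + n2)) * (y ^+ (k + e) * f1) - x ^+ e * (y ^+ e * mu) = 0.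
  by rewrite -{}jE /e !exprMn !exprD; ring.
have i1 : (r + k + e)%N%:Z = r%:Z + (k + e)%N%:Z by rewrite -PoszD addnA.
have j1 : (s + k + e)%N%:Z = (s + n2)%N%:Z + (k + (j + n1))%N%:Z.
  by rewrite -PoszD /e; congr Posz; lia.
have i2 : (r + k + e)%N%:Z = (r + n1)%N%:Z + (k + (j + n2))%N%:Z.
  by rewrite -PoszD /e; congr Posz; lia.
have j2 : (s + k + e)%N%:Z = s%:Z + (k + e)%N%:Z by rewrite -PoszD addnA.
have c1 := rees_coef_XYM Ia Jb f2 i1 j1; have c2 := rees_coef_XYM Ia Jb f1 i2 j2.
have c3 := rees_coef_XYM Ia Jb mu (PoszD (r + k) e) (PoszD (s + k) e).
have E := rees_coef_sub_eq0 jE c1 c2 c3; rewrite muE in E.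
exists e; rewrite exprMn -mulrA E.
exists (a ^+ (k + e) * (b ^+ (k + (j + n1)) * (rees_val f2)@_(r%:Z, (s + n2)%N%:Z))).
exists (b ^+ (k + e) * - (a ^+ (k + (j + n2)) * (rees_val f1)@_((r + n1)%N%:Z, s%:Z))).
split; last by rewrite mulrN [a ^+ (k + (j + n2)) * (b ^+ _ * _)]mulrCA.
- exists (b ^+ (k + (j + n1)) * (rees_val f2)@_(r%:Z, (s + n2)%N%:Z)) => //.
  have -> : (s + (k + e) = k + (j + n1) + (s + n2))%N by rewrite /e; lia.
  apply: (@powprod_mul _ _ _ 0 _ r); first exact: powprod_expr.
  exact: (rees_coef_mem f2 (r%:Z, (s + n2)%N%:Z)).
- exists (- (a ^+ (k + (j + n2)) * (rees_val f1)@_((r + n1)%N%:Z, s%:Z))) => //.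
  rewrite -mulN1r; apply: ideal_M.
  have -> : (r + (k + e) = k + (j + n2) + (r + n1))%N by rewrite /e; lia.
  apply: (@powprod_mul _ _ _ _ 0 _ s); first exact: powprod_expl.
  exact: (rees_coef_mem f1 ((r + n1)%N%:Z, s%:Z)).
Qed.

(** The term [a^k v] cancels [x^k] and comes from the localization at [y]; the term [b^k w] comes
    from the one at [x], with a sign because of the differential. *)
Lemma h2map_koszul_den k u : koszul_den k u -> h2map k u = 0.
Proof.
move=> Du; apply/quot_class_eqP; rewrite subr0.
have [_ [_ [[v Iv <-] [w Iw <-] uE]]] := Du.
exists (Defs.frac x (- rees_mono I J (r + k) s w) k,
        Defs.frac y (rees_mono I J r (s + k) v) k) => //.
rewrite /cech_d1 /= cech_from_xE cech_from_yE fracN mulrN opprK frac_addl.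
rewrite rees_monoXM // rees_monoYM // uE rees_monoD //; first last.
- rewrite [(s + k)%N]addnC; apply: (@powprod_mul _ _ _ 0 k) => //.
  exact: powprod_expr.
- by rewrite addnC; apply: (@powprod_mul _ _ _ k 0) => //; apply: powprod_expl.
Qed.

Lemma rees_H2_componentP w : (@rees_H2_component R I J a b Ia Jb r%:Z s%:Z) w <->
  exists k, exists2 u, P k u & w = h2map k u.
Proof.
split.
  move=> [_ [f [k [hf ->]] <-]]; exists k, (rees_val f)@_((r + k)%N%:Z, (s + k)%N%:Z).
    exact: (rees_coef_mem f ((r + k)%N%:Z, (s + k)%N%:Z)).
  by rewrite /h2map -homogeneous_rees_mono.
move=> [k [u _ ->]]; exists (Defs.frac (x * y) (rees_mono I J (r + k) (s + k) u) k) => //.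
by exists (rees_mono I J (r + k) (s + k) u), k; split=> //; apply: rees_mono_homogeneous.
Qed.

Lemma rees_H2_component_submodule : is_submodule (@rees_H2_component R I J a b Ia Jb r%:Z s%:Z).
Proof.
split.
- apply/rees_H2_componentP; exists 0%N, 0; first exact: ideal_0.
  by apply/esym/h2map_koszul_den; case: (koszul_den_ideal 0).
- move=> _ _ /rees_H2_componentP[k [u Pu ->]] /rees_H2_componentP[l [v Pv ->]].
  apply/rees_H2_componentP; rewrite (h2map_step l Pu) (h2map_step k Pv) [(l + k)%N]addnC.
  have Pu' := powprod_step l Pu; have Pv' := powprod_step k Pv; rewrite [(l + k)%N]addnC in Pv'.
  by eexists; eexists; last (apply/esym; apply: h2mapD => //); apply: ideal_D.
- move=> c _ /rees_H2_componentP[k [u Pu ->]]; apply/rees_H2_componentP.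
  by exists k, (c * u); [apply: ideal_M|rewrite -h2mapZ].
Qed.

Lemma h2map_image_submodule k : is_submodule (h2map k @` P k).
Proof.
split.
- exists 0; first exact: ideal_0.
  by apply: h2map_koszul_den; case: (koszul_den_ideal k).
- move=> _ _ [u Pu <-] [v Pv <-]; exists (u + v); first exact: ideal_D.
  exact: h2mapD.
- by move=> c _ [u Pu <-]; exists (c * u); [apply: ideal_M|rewrite -h2mapZ].
Qed.

Lemma submodule0 : is_submodule [set 0 : rees_H2 Ia Jb].
Proof.
by split=> [//|u v -> ->|c u ->]; rewrite /= ?addr0 ?scaler0.
Qed.

Section Injective.
Variable N : nat.
Hypothesis den_inj : forall k, (N <= k)%N -> forall u, P k u ->
  koszul_den k.+1 (a * b * u) -> koszul_den k u.

(** Injective transition maps let the exponent [j] of [h2map_eq0] be removed one step at a time, so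
    each term from [N] on embeds in the limit. *)
Lemma h2map_eq0E k u : (N <= k)%N -> P k u -> h2map k u = 0 <-> koszul_den k u.
Proof.
move=> Nk Pu; split; last exact: h2map_koszul_den.
move=> /(h2map_eq0 Pu)[j]; elim: j k u Nk Pu => [|j IHj] k u Nk Pu.
  by rewrite addn0 mul1r.
rewrite exprSr -mulrA addnS -addSn => H; apply: den_inj => //.
apply: IHj H; first exact: leqW.
by have := powprod_step 1 Pu; rewrite addn1.
Qed.

Lemma length_h2map_image k : (N <= k)%N ->
  length [set 0] (h2map k @` P k) = len (koszul_den k) (P k).
Proof.
move=> Nk; apply/esym/(@length_morph R R^o _ (h2map k)).
- exact: koszul_den_ideal.
- exact: ideal_submodule.
- exact: koszul_den_sub.
- exact: submodule0.
- exact: h2map_image_submodule.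
- by move=> _ ->; case: (h2map_image_submodule k).
- exact: h2mapD.
- exact: h2mapZ.
- by move=> u Pu; exists u.
- by move=> _ [u Pu <-]; exists u; rewrite //= subrr.
- by move=> u Pu; apply: h2map_eq0E.
Qed.

Lemma h2map_image_sub k : h2map k @` P k `<=` (@rees_H2_component R I J a b Ia Jb r%:Z s%:Z).
Proof. by move=> _ [u Pu <-]; apply/rees_H2_componentP; exists k, u. Qed.

Lemma length_koszul_den_le k z : (N <= k)%N -> length_H2 Ia Jb r%:Z s%:Z = z%:E ->
  exists2 d, len (koszul_den k) (P k) = d%:E & d <= z.
Proof.
move=> Nk lz; rewrite -length_h2map_image //.
have [|p [q [-> lq ->]]] := length_split submodule0 (h2map_image_submodule k)
  rees_H2_component_submodule _ (@h2map_image_sub k) lz.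
  by move=> _ ->; case: (h2map_image_submodule k).
by exists p => //; rewrite lerDl (length_ge0 lq).
Qed.

(** The images of the [h2map k] increase with [k]; equal finite lengths force them to coincide from
    [N] on, and their union is the component. *)
Lemma length_H2_stable z :
  (forall k, (N <= k)%N -> len (koszul_den k) (P k) = z%:E) ->
  length_H2 Ia Jb r%:Z s%:Z = z%:E.
Proof.
move=> lz; rewrite -(lz N) // -length_h2map_image //; congr length.
apply/seteqP; split; last exact: h2map_image_sub.
move=> w /rees_H2_componentP[k [u Pu ->]].
(* Raising an element to level [N + k] puts it beyond [N], whatever its original level. *)
rewrite (h2map_step N Pu) [(k + N)%N]addnC.
have step : h2map N @` P N `<=` h2map (N + k) @` P (N + k).
  by move=> _ [v Pv <-]; exists ((a * b) ^+ k * v); [exact: powprod_step|rewrite -h2map_step].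
apply: (length0_sub (h2map_image_submodule _) (h2map_image_submodule (N + k)) step).
  have [] := length_split submodule0 (h2map_image_submodule N)
    (h2map_image_submodule (N + k)) _ step (z := z).
  - by move=> _ ->; case: (h2map_image_submodule N).
  - by rewrite length_h2map_image ?lz // leq_addr.
  - move=> p [q [+ -> zE]]; rewrite length_h2map_image // lz // => -[zp].
    by move/eqP: zE; rewrite zp -subr_eq0 opprD addrA subrr sub0r oppr_eq0 => /eqP ->.
by exists ((a * b) ^+ N * u) => //; rewrite [(N + k)%N]addnC; apply: powprod_step.
Qed.

End Injective.

End LocalCohomology.

(** * Lengths for a Rees joint reduction *)

Section ReesJointReduction.
Variables (R : comNzRingType) (I J : ideal R) (a b : R) (Ia : I a) (Jb : J b).
Hypothesis ab_reg : regular_pair a b.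
Local Notation F r s := (powprod I J r s).
Local Notation is_ideal := (@is_submodule R R^o).
Local Notation len N M := (@length R R^o N M).

(** If [a u] lies in [I^(r+1) J^s], the Rees condition writes it as [a v] with [v] in [I^r J^s], and
    [u = v] as [a] is regular; likewise for [b]. *)
Lemma rees_joint_reduction_cancel : rees_joint_reduction I J a b ->
  exists N, [/\ forall r s, (N <= r)%N -> (N <= s)%N ->
      F r.+1 s.+1 = joint_reduction_module_den I J a b r s :> set R,
    forall r s u, (N <= r)%N -> F r.+1 s (a * u) -> F r s u &
    forall r s u, (N <= s)%N -> F r s.+1 (b * u) -> F r s u].
Proof.
move=> [[_ _ [N0 N0P]] [N1 N1P] [N2 N2P]]; have [ra rb _] := ab_reg.
exists (maxn N0 (maxn N1 N2)); split=> [r s|r s u|r s u]; rewrite !geq_max.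
- by move=> /andP[? _] /andP[? _]; apply: N0P.
- move=> /and3P[_ Nr _] Fau; have : scale_set a (F r s) (a * u).
    by rewrite -N1P //; split=> //; exists u.
  by move=> [v Fv /ra <-].
- move=> /and3P[_ _ Ns] Fbu; have : scale_set b (F r s) (b * u).
    by rewrite -N2P //; split=> //; exists u.
  by move=> [v Fv /rb <-].
Qed.

Variable N : nat.
Hypothesis joint : forall r s, (N <= r)%N -> (N <= s)%N ->
  F r.+1 s.+1 = joint_reduction_module_den I J a b r s :> set R.
Hypothesis cancel_a : forall r s u, (N <= r)%N -> F r.+1 s (a * u) -> F r s u.
Hypothesis cancel_b : forall r s u, (N <= s)%N -> F r s.+1 (b * u) -> F r s u.

(** From [a b u = a^(k+1) v + b^(k+1) w], regularity gives [v = b v'] and [w = a w'], hence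
    [u = a^k v' + b^k w']; the cancellation properties put [v'] and [w'] in the required products of
    powers. *)
Lemma koszul_den_inj r s k : (N <= k)%N -> forall u, F (r + k) (s + k) u ->
  koszul_den I J a b r s k.+1 (a * b * u) -> koszul_den I J a b r s k u.
Proof.
move=> Nk u _ [_ [_ [[v Iv <-] [w Iw <-] E]]]; have [ra rb _] := ab_reg.
have [_ _ abk] := regular_pairXl k.+1 ab_reg.
have [_ _ bak] := regular_pairXl k.+1 (regular_pair_sym ab_reg).
have [|v' vE] := abk v (a * u - b ^+ k * w).
  by rewrite mulrBr mulrA [b * a]mulrC E [b ^+ k.+1]exprS -mulrA addrK.
have [|w' wE] := bak w (b * u - a ^+ k * v).
  by rewrite mulrBr mulrA E [a ^+ k.+1]exprS -mulrA addrAC subrr add0r.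
exists (a ^+ k * v'), (b ^+ k * w'); split.
- exists v' => //; apply: cancel_b; first by rewrite (leq_trans Nk) ?leq_addl.
  by rewrite -vE -addnS.
- exists w' => //; apply: cancel_a; first by rewrite (leq_trans Nk) ?leq_addl.
  by rewrite -wE -addnS.
- by apply: rb; apply: ra; rewrite !mulrA E vE wE !exprS; ring.
Qed.

Definition joint_colon r s k : set R :=
  colon_set (F (r + k) s) (a ^+ k) `&` colon_set (F r (s + k)) (b ^+ k).

Lemma joint_colon_ideal r s k : is_ideal (joint_colon r s k).
Proof. by apply: setI_ideal; apply: colon_set_ideal; apply: ideal_submodule. Qed.

(** The ideals [joint_colon r s k] ascend with [k], as [a] lies in [I] and [b] in [J], so their
    union is attained. *)
Lemma joint_colon_stable r s : noetherian R ->
  exists l, forall k, (l <= k)%N -> joint_colon r s k = joint_ratliff_rush I J a b r s.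
Proof.
move=> noeth; have colonS k : joint_colon r s k `<=` joint_colon r s k.+1.
  move=> u [Fa Fb]; split; rewrite /colon_set /= exprS -mulrA addnS -add1n.
    by apply: (@powprod_mul _ _ _ 1 0) => //; apply: (powprod_expl J 1 Ia).
  by apply: (@powprod_mul _ _ _ 0 1) => //; apply: (powprod_expr I 1 Jb).
have [l lP] := noetherian_acc noeth (joint_colon_ideal r s) colonS.
(* The union defining the closure starts at exponent 1, hence the maximum with 1. *)
exists (maxn l 1) => k; rewrite geq_max => /andP[lk k1].
apply/seteqP; split=> [u cu|u [j _ cu]]; first by exists k.
rewrite lP // -(lP (maxn l j)) ?leq_maxl //.
have jm : (j <= maxn l j)%N by rewrite leq_maxr.
have {}cu : joint_colon r s j u by [].
by elim: (maxn l j) jm => [|i IHi]; [rewrite leqn0 => /eqP <-|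
  rewrite leq_eqVlt => /predU1P[<- //|/IHi /colonS]].
Qed.

Lemma joint_colon_sub r s k : F r s `<=` joint_colon r s k.
Proof.
move=> u Fu; split; rewrite /colon_set /=.
  by rewrite addnC; apply: (@powprod_mul _ _ _ k 0) => //; apply: powprod_expl.
by rewrite addnC; apply: (@powprod_mul _ _ _ 0 k) => //; apply: powprod_expr.
Qed.

Variables (L : nat -> nat -> int) (E : int).
Hypothesis lenL : forall r s, colength (F r s) = (L r s)%:E.
Hypothesis lenE : colength (sum_set (scale_set a setT) (scale_set b setT)) = E%:E.

(** [colength_regular_pair] for [I^r J^(s+1)] and [I^(r+1) J^s]: the colon ideals meet in [I^r J^s]
    once a single one of the indices is large. *)
Lemma length_M1E r s : (N <= r)%N || (N <= s)%N ->
  length_M1 I J a b r s =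
    (E + L r s.+1 + L r.+1 s - L r s - L r.+1 s.+1)%:E.
Proof.
move=> Nrs; rewrite /length_M1.
have sI := @ideal_submodule R.
have [y [z [ly lz yz]]] := colength_regular_pair ab_reg (sI _) (sI _)
  (lenL r s.+1) (lenL r.+1 s) lenE.
have zE : z = L r s.
  suff cE : colon_set (F r s.+1) b `&` colon_set (F r.+1 s) a = F r s.
    by move: lz; rewrite cE lenL => -[].
  apply/seteqP; split=> [u [Fb Fa]|u Fu].
    by case/orP: Nrs => Nrs; [apply: cancel_a|apply: cancel_b].
  by rewrite setIC; have := @joint_colon_sub r s 1 u Fu; rewrite /joint_colon !addn1 !expr1.
have := koszul_den_ideal I J a b r s 1; have := @koszul_den_sub _ I J a b Ia Jb r s 1.
rewrite /koszul_den !addn1 !expr1 => denF sden.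
have [p [q [lp]]] := colength_fin sden (sI _) denF ly.
by rewrite lenL lp => -[<-] yE; congr (_%:E); rewrite -yz zE yE; ring.
Qed.

Lemma length_M1_eq0 r s : (N <= r)%N -> (N <= s)%N -> length_M1 I J a b r s = 0%:E.
Proof.
by move=> Nr Ns; rewrite /length_M1 -joint //; apply: lengthxx; apply: ideal_submodule.
Qed.

(** The same computation for the pair [a^k, b^k], with [E] multiplied by [k^2]; for large [k] the
    colon ideals meet in the closure, of colength [Z]. *)
Lemma length_ratliff_rush r s : noetherian R -> exists Z,
  [/\ colength (joint_ratliff_rush I J a b r s) = Z%:E,
    len (F r s) (joint_ratliff_rush I J a b r s) = (L r s - Z)%:E &
    eventually (fun k => len (koszul_den I J a b r s k) (F (r + k) (s + k)) =
      (k%:Z * k%:Z * E + L r (s + k) + L (r + k) s - L (r + k) (s + k) - Z)%:E)].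
Proof.
move=> noeth; have [l lP] := joint_colon_stable r s noeth.
have sI := @ideal_submodule R.
have srr : is_ideal (joint_ratliff_rush I J a b r s).
  by rewrite -(lP l) //; apply: joint_colon_ideal.
have Frr : F r s `<=` joint_ratliff_rush I J a b r s.
  by rewrite -(lP l) //; apply: joint_colon_sub.
have [p [Z [lp lZ LE]]] := colength_fin (sI _) srr Frr (lenL r s).
exists Z; split=> //; first by rewrite lp LE addrK.
exists l => k lk.
have [y [z [ly lz yz]]] := colength_regular_pair (regular_pairX k k ab_reg) (sI _) (sI _)
  (lenL r (s + k)) (lenL (r + k) s) (colength_regular_pairX k k ab_reg lenE).
have zE : z = Z by move: lz; rewrite setIC [X in colength X]lP // lZ => -[].
have [p' [q [lp']]] := colength_fin (koszul_den_ideal I J a b r s k) (sI _)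
  (@koszul_den_sub _ I J a b Ia Jb r s k) ly.
by rewrite lenL lp' => -[<-] yE; congr (_%:E); rewrite -yz zE yE; ring.
Qed.

End ReesJointReduction.

(** * Hilbert polynomials *)

Section HilbertPolynomials.
Local Notation T n := ('C(n.+1, 2)%:Z).

Lemma bin2S n : T n.+1 = T n + n%:Z + 1 :> int.
Proof. by rewrite binS bin1 PoszD intS; ring. Qed.

Lemma bin2_square n : n%:Z * n%:Z = T n *+ 2 - n%:Z :> int.
Proof. by elim: n => [//|n IHn]; rewrite bin2S intS; move: IHn => H; lra. Qed.

(** Successive differences at [N], [N + 1], [N + 2] isolate [A], then [B], then [C]. *)
Lemma quadratic_eq0 (A B C : int) N :
  (forall n : nat, (N <= n)%N -> A * T n + B * n%:Z + C = 0) -> [/\ A = 0, B = 0 & C = 0].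
Proof.
move=> f0; have := f0 N (leqnn _); have := f0 N.+1 (leqnSn _).
have := f0 N.+2 (leqW (leqnSn _)); rewrite !bin2S !intS => f2 f1 f.
have A0 : A = 0 by lra.
move: f1 f; rewrite A0 => f1 f; have B0 : B = 0 by lra.
by move: f; rewrite B0 => f; split=> //; lra.
Qed.

(** The link between (b) and (c): it is applied to [g1 r + r e11] with limit [e01] and to
    [h1 s + s e11] with limit [e10]. *)
Lemma nondecreasing_eventually (f : nat -> int) n c r :
  (forall i, f i <= f i.+1) -> (forall i, (n <= i)%N -> f i = c) ->
  f r <= c /\ (f r = c <-> forall i, (r <= i)%N -> f i.+1 - f i = 0).
Proof.
move=> fS fc.
have fle i j : (i <= j)%N -> f i <= f j.
  move=> /subnK <-; elim: (j - i)%N => [//|k IHk]; apply: le_trans IHk _.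
  exact: fS.
have flec i : f i <= c by rewrite -(fc (maxn i n)) ?leq_maxr // fle // leq_maxl.
split=> //; split=> [fr i ri|fS0].
  suff fic j : (r <= j)%N -> f j = c by rewrite !fic ?subrr // leqW.
  by move=> rj; apply/eqP; rewrite eq_le flec -fr fle.
rewrite -(fc (maxn n r)) ?leq_maxl //.
have : (r <= maxn n r)%N by rewrite leq_maxr.
move=> /subnK <-; elim: (_ - _)%N => [//|k ->].
by apply/eqP; rewrite eq_sym -subr_eq0 fS0 // leq_addl.
Qed.

Variables (L : nat -> nat -> int) (E e00 e01 e02 e10 e11 e20 eI0 eJ0 : int).
Variables (g1 g2 h1 h2 : nat -> int) (N : nat).
Hypothesis LP : forall r s, (N <= r)%N -> (N <= s)%N ->
  L r s = e00 - e01 * s%:Z + e02 * T s - e10 * r%:Z + e11 * r%:Z * s%:Z + e20 * T r.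
Hypothesis LG : forall r, eventually (fun s => L r s = eJ0 * T s - g1 r * s%:Z + g2 r).
Hypothesis LH : forall s, eventually (fun r => L r s = eI0 * T r - h1 s * r%:Z + h2 s).

(** [E] minus the mixed second difference of [L]; by [length_M1E] this is the length of the module
    [M^1] at [(r, s)] when one index is large. *)
Definition mixed_diff r s : int := E + L r s.+1 + L r.+1 s - L r s - L r.+1 s.+1.

Hypothesis mixed0 : forall r s, (N <= r)%N -> (N <= s)%N -> mixed_diff r s = 0.

(** The mixed second difference of the Hilbert polynomial is [e11], and [mixed_diff] vanishes for
    large indices. *)
Lemma colength_eq_e11 : E = e11.
Proof.
have := mixed0 (leqnn N) (leqnn N); rewrite /mixed_diff !LP // !bin2S !intS => H.
lra.
Qed.

(** For [r] beyond [N], both expansions of [L r s] hold for large [s], so their coefficients as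
    polynomials in [s] agree. *)
Lemma row_coeffs r : (N <= r)%N -> e02 = eJ0 /\ g1 r + r%:Z * e11 = e01.
Proof.
move=> Nr; have [M MP] := LG r.
have [|A0 B0 _] := @quadratic_eq0 (e02 - eJ0) (g1 r + r%:Z * e11 - e01)
    (e00 - e10 * r%:Z + e20 * T r - g2 r) (maxn N M).
  move=> s; rewrite geq_max => /andP[Ns Ms].
  have := MP s Ms; rewrite LP // => H; lra.
by split; lra.
Qed.

Lemma col_coeffs s : (N <= s)%N -> e20 = eI0 /\ h1 s + s%:Z * e11 = e10.
Proof.
move=> Ns; have [M MP] := LH s.
have [|A0 B0 _] := @quadratic_eq0 (e20 - eI0) (h1 s + s%:Z * e11 - e10)
    (e00 - e01 * s%:Z + e02 * T s - h2 s) (maxn N M).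
  move=> r; rewrite geq_max => /andP[Nr Mr].
  have := MP r Mr; rewrite LP // => H; lra.
by split; lra.
Qed.

Lemma mixed_diff_row r : eventually (fun s =>
  mixed_diff r s = (g1 r.+1 + r.+1%:Z * e11) - (g1 r + r%:Z * e11)).
Proof.
have [M MP] := LG r; have [M' MP'] := LG r.+1.
exists (maxn M M') => s; rewrite geq_max => /andP[Ms Ms'].
rewrite /mixed_diff !(MP, MP') ?(leq_trans Ms, leq_trans Ms') //.
by rewrite colength_eq_e11 !bin2S !intS; ring.
Qed.

Lemma mixed_diff_col s : eventually (fun r =>
  mixed_diff r s = (h1 s.+1 + s.+1%:Z * e11) - (h1 s + s%:Z * e11)).
Proof.
have [M MP] := LH s; have [M' MP'] := LH s.+1.
exists (maxn M M') => r; rewrite geq_max => /andP[Mr Mr'].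
rewrite /mixed_diff !(MP, MP') ?(leq_trans Mr, leq_trans Mr') //.
by rewrite colength_eq_e11 !bin2S !intS; ring.
Qed.

(** The three colengths are expanded by [LG], [LH] and [LP] respectively. The binomial terms cancel
    as [e02 = eJ0] and [e20 = eI0], and [E k^2] cancels the square in [e11 (r+k) (s+k)]. *)
Lemma koszul_length_linear r s Z : eventually (fun k : nat =>
  k%:Z * k%:Z * E + L r (s + k) + L (r + k) s - L (r + k) (s + k) - Z =
  (e10 - h1 s - s%:Z * e11 + (e01 - g1 r - r%:Z * e11)) * k%:Z +
  ((e10 - h1 s) * r%:Z + (e01 - g1 r) * s%:Z - r%:Z * s%:Z * e11
   + g2 r + h2 s - e00 - Z)).
Proof.
have [M MP] := LG r; have [M' MP'] := LH s.
exists (maxn N (maxn M M')) => k; rewrite !geq_max => /and3P[Nk Mk Mk'].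
rewrite MP ?MP' ?LP ?(leq_trans Nk, leq_trans Mk, leq_trans Mk', leq_addl) //.
have [-> _] := row_coeffs (leqnn N); have [-> _] := col_coeffs (leqnn N).
by rewrite colength_eq_e11 !PoszD; ring.
Qed.

End HilbertPolynomials.

(** * Data extracted from the hypotheses, and the theorem *)

Lemma eventual_valueE (u : nat -> \bar int) v :
  eventually (fun n => u n = v) -> eventual_value u = v.
Proof.
move=> [M MP]; rewrite /eventual_value; case: pselect => [h|[]]; last by exists v, M.
case: (cid h) => w [M' MP'] /=.
by rewrite -(MP (maxn M M')) ?leq_maxl // MP' ?leq_maxr.
Qed.

(** An element [x] of [m] has powers in [I] and in [J], so a high power lies in [I^(N+1) J^(N+1)],
    which the joint reduction puts inside [(a, b)]. The depth equals the dimension two. *)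
Lemma joint_reduction_regular (R : comNzRingType) (m I J : ideal R) a b :
  cohen_macaulay_local m -> krull_dim R 2 -> primary_to m I -> primary_to m J ->
  joint_reduction I J a b -> regular_pair a b.
Proof.
move=> [noeth loc [d [dimd depd]]] dim2 [_ radI] [_ radJ] [Ia Jb [N NP]].
apply: (regular_pair_of_depth noeth loc).
- by exists d; split=> //; rewrite (is_max_nat_uniq dimd dim2).
- by rewrite -radI; exists 1%N.
- by rewrite -radJ; exists 1%N.
move=> x mx; have : radical_set I x by rewrite radI.
have : radical_set J x by rewrite radJ.
move=> [l Jx] [k Ix]; exists (k * N.+1 + l * N.+1)%N.
have : powprod I J N.+1 N.+1 (x ^+ (k * N.+1 + l * N.+1)).
  rewrite exprD !exprM; have := powprod_mul (powprod_expl J N.+1 Ix) (powprod_expr I N.+1 Jx).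
  by rewrite addn0.
rewrite NP // => -[_ [_ [[u _ <-] [v _ <-] ->]]].
by exists u, v; rewrite mulrC [v * b]mulrC.
Qed.

(** The Hilbert polynomial yields finiteness only for large indices; any [I^r J^s] contains a
    product with large indices. *)
Lemma colength_powprod_finite (R : comNzRingType) (I J : ideal R) e :
  bigraded_hilbert_coeffs I J e ->
  exists L : nat -> nat -> int, forall r s, colength (powprod I J r s) = (L r s)%:E.
Proof.
move=> [N NP]; have sI := @ideal_submodule R.
have fin (p : nat * nat) : exists z, colength (powprod I J p.1 p.2) = z%:E.
  have := NP (p.1 + N)%N (p.2 + N)%N (leq_addl _ _) (leq_addl _ _).
  move=> /(colength_fin (sI _) (sI (powprod I J p.1 p.2)))[|_ [z [_ lz _]]].
    by move=> u; apply: powprod_le; apply: leq_addr.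
  by exists z.
by have [L LP] := choice fin; exists (fun r s => L (r, s)) => r s; rewrite -LP.
Qed.

Lemma bigraded_hilbert_coeffsE (R : comNzRingType) (I J : ideal R) e
    (L : nat -> nat -> int) :
  (forall r s, colength (powprod I J r s) = (L r s)%:E) ->
  bigraded_hilbert_coeffs I J e -> exists N, forall r s, (N <= r)%N -> (N <= s)%N ->
  L r s = e 0 0 - e 0 1 * s%:Z + e 0 2 * 'C(s.+1, 2)%:Z - e 1 0 * r%:Z
    + e 1 1 * r%:Z * s%:Z + e 2 0 * 'C(r.+1, 2)%:Z.
Proof.
move=> lenL [N NP]; exists N => r s Nr Ns; have := NP r s Nr Ns; rewrite lenL => -[->].
under eq_bigr do rewrite big_mkcond.
(* At [i = 0] the truncated [r + i - 1] is harmless, since its binomial coefficient is 1 anyway. *)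
rewrite !big_ord_recl !big_ord0 /= !(addn0, addn1, subn1, addn2, bin0, bin1, subn0) /=.
ring.
Qed.

Theorem theorem4p3 (R : comNzRingType) (m I J : ideal R)
  (R_cm : cohen_macaulay_local m) (R_dim : krull_dim R 2)
  (R_res : infinite_residue_field m)
  (I_prim : primary_to m I) (J_prim : primary_to m J)
  (a b : R) (Ia : I a) (Jb : J b) (ab_rees : rees_joint_reduction I J a b)
  (eI eJ eIJ : nat -> int) (e : nat -> nat -> int)
  (eI_def : hilbert_coeffs I eI) (eJ_def : hilbert_coeffs J eJ)
  (eIJ_def : hilbert_coeffs (ideal_mul I J) eIJ)
  (e_def : bigraded_hilbert_coeffs I J e)
  (g1 g2 h1 h2 : nat -> int)
  (g_def : row_hilbert_coeffs I J (eJ 0%N) g1 g2)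
  (h_def : col_hilbert_coeffs I J (eI 0%N) h1 h2)
  (r0 s0 : nat) :
  let cond_a := (length_H2 Ia Jb r0%:Z s0%:Z < +oo)%E in
  let cond_b := e 0%N 1%N = g1 r0 + r0%:Z * e 1%N 1%N /\
                e 1%N 0%N = h1 s0 + s0%:Z * e 1%N 1%N in
  let cond_c := (forall i : nat, (r0 <= i)%N -> M1_row I J a b i = 0%E) /\
                (forall j : nat, (s0 <= j)%N -> M1_col I J a b j = 0%E) in
  [/\ cond_a <-> cond_b, cond_b <-> cond_c &
      cond_a \/ cond_b \/ cond_c ->
      length_H2 Ia Jb r0%:Z s0%:Z =
        ((- eIJ 2%N + g2 r0 + h2 s0)%R%:E - colength (powprod I J r0 s0)
         + (r0%:Z * s0%:Z * e 1%N 1%N)%R%:E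
         + @length R R^o (powprod I J r0 s0) (joint_ratliff_rush I J a b r0 s0))%E].
Proof.
have [noeth _ _] := R_cm; have [joint_ab _ _] := ab_rees.
have reg := joint_reduction_regular R_cm R_dim I_prim J_prim joint_ab.
have [N0 [joint cancel_a cancel_b]] := rees_joint_reduction_cancel reg ab_rees.
have [L lenL] := colength_powprod_finite e_def.
have [N1 LP1] := bigraded_hilbert_coeffsE lenL e_def.
pose N := maxn N0 N1.
have N0N : (N0 <= N)%N by rewrite leq_maxl.
have LP r s : (N <= r)%N -> (N <= s)%N -> _ := fun Nr Ns =>
  LP1 r s (leq_trans (leq_maxr N0 N1) Nr) (leq_trans (leq_maxr N0 N1) Ns).
have sT := is_idealT R; have sI := @ideal_submodule R.
(* Finite, as [(a, b)] contains [I^(N0+1) J^(N0+1)]. *)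
have [E lenE] : exists E, colength (sum_set (scale_set a setT) (scale_set b setT)) = E%:E.
  have sQ := sum_set_ideal (scale_set_ideal a sT) (scale_set_ideal b sT).
  have FQ : powprod I J N0.+1 N0.+1 `<=` sum_set (scale_set a setT) (scale_set b setT).
    rewrite joint //; move=> _ [_ [_ [[u _ <-] [v _ <-] ->]]].
    by exists (a * u), (b * v); split=> //; [exists u|exists v].
  have [_ [E [_ lE _]]] := colength_fin (sI _) sQ FQ (lenL _ _).
  by exists E.
have lenM r s := length_M1E Ia Jb reg cancel_a cancel_b lenL lenE (r := r) (s := s).
have mixed0 r s : (N <= r)%N -> (N <= s)%N -> mixed_diff L E r s = 0.
  move=> Nr Ns; have := length_M1_eq0 joint (leq_trans N0N Nr) (leq_trans N0N Ns).
  by rewrite lenM ?(leq_trans N0N Nr) // => -[].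
have LG r : eventually (fun s => L r s = eJ 0 * 'C(s.+1, 2)%:Z - g1 r * s%:Z + g2 r).
  by have [M MP] := g_def r; exists M => s /MP; rewrite lenL => -[].
have LH s : eventually (fun r => L r s = eI 0 * 'C(r.+1, 2)%:Z - h1 s * r%:Z + h2 s).
  by have [M MP] := h_def s; exists M => r /MP; rewrite lenL => -[].
pose G r := g1 r + r%:Z * e 1 1; pose H s := h1 s + s%:Z * e 1 1.
have M1r r : M1_row I J a b r = (G r.+1 - G r)%:E.
  apply: eventual_valueE; have [M MP] := mixed_diff_row LP LG mixed0 r.
  exists (maxn N0 M) => s; rewrite geq_max => /andP[Ns Ms].
  by rewrite lenM ?Ns ?orbT // -(MP s Ms).
have M1c s : M1_col I J a b s = (H s.+1 - H s)%:E.
  apply: eventual_valueE; have [M MP] := mixed_diff_col LP LH mixed0 s.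
  exists (maxn N0 M) => r; rewrite geq_max => /andP[Nr Mr].
  by rewrite lenM ?Nr // -(MP r Mr).
have GS r : G r <= G r.+1.
  have [M MP] := mixed_diff_row LP LG mixed0 r.
  rewrite -subr_ge0 -(MP (maxn N0 M)) ?leq_maxr //.
  by apply: length_ge0 (lenM _ _ _); rewrite leq_maxl orbT.
have HS s : H s <= H s.+1.
  have [M MP] := mixed_diff_col LP LH mixed0 s.
  rewrite -subr_ge0 -(MP (maxn N0 M)) ?leq_maxr //.
  by apply: length_ge0 (lenM _ _ _); rewrite leq_maxl.
have [Gle GE] := nondecreasing_eventually r0 GS (fun r Nr => proj2 (row_coeffs LP LG Nr)).
have [Hle HE] := nondecreasing_eventually s0 HS (fun s Ns => proj2 (col_coeffs LP LH Ns)).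
have [Z [lenZ lenFZ [K KP]]] := length_ratliff_rush Ia Jb reg lenL lenE r0 s0 noeth.
have [K' KP'] := koszul_length_linear LP LG LH mixed0 r0 s0 Z.
set slope := (X in forall k, _ -> _ = X * _ + _) in KP'.
set cst := (X in forall k, _ -> _ = _ * _ + X) in KP'.
have den_inj := koszul_den_inj reg cancel_a cancel_b (r := r0) (s := s0).
have e00 : e 0 0 = eIJ 2.
  have [M MP] := eIJ_def.
  (* The diagonal of the bigraded polynomial, with [n^2] rewritten as [2 C(n+1, 2) - n], minus the
     polynomial of [IJ]; its constant term must vanish. *)
  have [|_ _ /eqP] := @quadratic_eq0 (e 0 2 + e 2 0 + e 1 1 *+ 2 - eIJ 0)
      (eIJ 1 - e 0 1 - e 1 0 - e 1 1) (e 0 0 - eIJ 2) (maxn N M).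
    move=> n; rewrite geq_max => /andP[Nn Mn].
    have := MP n Mn; rewrite ideal_exp_mul lenL => -[]; rewrite LP // -mulrA bin2_square => E0.
    by lra.
  by rewrite subr_eq0 => /eqP.
move=> cond_a cond_b cond_c.
have bP : cond_b <-> G r0 = e 0 1 /\ H s0 = e 1 0.
  by rewrite /cond_b /G /H; split=> -[-> ->].
have bc : cond_b <-> cond_c.
  rewrite bP GE HE /cond_c; split=> -[c1 c2]; split=> i /[dup] ri.
  - by move=> /c1; rewrite M1r => ->.
  - by move=> /c2; rewrite M1c => ->.
  - by move=> /c1; rewrite M1r => -[].
  - by move=> /c2; rewrite M1c => -[].
have lenH : cond_b -> length_H2 Ia Jb r0%:Z s0%:Z = cst%:E.
  move=> /bP[Gr Hs].
  apply: (@length_H2_stable R I J a b Ia Jb r0 s0 (maxn N0 (maxn K K'))) => k.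
    by rewrite !geq_max => /andP[Nk _]; apply: den_inj.
  rewrite !geq_max => /and3P[_ Kk Kk']; rewrite KP // KP' //.
  suff -> : slope = 0 by rewrite mul0r add0r.
  by rewrite /slope -Gr -Hs /G /H; ring.
have ab : cond_a <-> cond_b.
  split; last by rewrite /cond_a => /lenH ->; rewrite ltry.
  have [[z lz] _|loo] := length_finVoo [set 0]
      (@rees_H2_component R I J a b Ia Jb r0%:Z s0%:Z).
    have slope_le0 : slope <= 0.
      rewrite leNgt; apply/negP => slope_gt0.
      (* This level is large enough for all formulas and exceeds [z - cst], so a slope of at least 1
         would give a length above [z]. *)
      pose k := (maxn N0 (maxn K K') + `|z - cst|.+1)%N.
      have : (maxn N0 (maxn K K') <= k)%N by rewrite leq_addr.
      rewrite !geq_max => /and3P[Nk Kk Kk'].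
      have [d] := length_koszul_den_le den_inj Nk lz.
      rewrite KP // KP' // => -[<-]; rewrite -lerBrDr.
      have : k%:Z <= slope * k%:Z by rewrite ler_peMl.
      have : z - cst < k%:Z by rewrite (le_lt_trans (ler_norm _)) // -abszE ltz_nat /k; lia.
      by lia.
    have slopeE : slope = (e 1 0 - H s0) + (e 0 1 - G r0).
      by rewrite /slope /G /H; ring.
    by apply/bP; split; lia.
  by rewrite /cond_a /length_H2 loo ltxx.
(* The stated formula is checked under (b), to which each alternative has been reduced. *)
split=> // abc; have hb : cond_b by case: abc => [/ab //|[//|/bc]].
rewrite (lenH hb) lenL lenFZ -EFinB -!EFinD; congr (_%:E).
(* By (b) the products in [cst] involving [r0] or [s0] add up to [r0 s0 e11], while [- Z] is split
   as [(L r0 s0 - Z) - L r0 s0]. *)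
by have [E01 E10] := hb; rewrite /cst E01 E10 e00; ring.
Qed.
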